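(* Let $p$ be a prime, $q = p^s$, $r = q^t$ with integers $s,t\ge1$, let $k\ge 0$ and $d\ge 2$ be integers, and let $\lambda \in \mathbb{F}_q^{*}$ with $\lambda \neq 1$; if $p\neq 2$ assume moreover $\lambda\neq 2$ and put $\mu := 2-\lambda$. Define $\Theta_k^t(\lambda)\in\mathbb{F}_q((T^{-1}))$ by the continued fraction \[ \Theta_k^t(\lambda) = \begin{cases} [0, T^{[k]}, \bigoplus_{i\ge1}\big(T, (\lambda T, \mu T)^{[(r^i-1)/2]}\big)^{[k+1]}] & \text{if } p\neq 2,\\ [0, T^{[k]}, \bigoplus_{i\ge1}\big(T, (\lambda T)^{[r^i-1]}\big)^{[k+1]}] & \text{if } p = 2.\end{cases} \] Then \[ w_2^*(\Theta_k^t(\lambda)) \ge \max\left\{\frac{r-1}{k+1},\ r-1-\frac{r(r-1)(r-4)}{2r(k+1)+(r-1)(r-2)}\right\}, \] \[ w_2(\Theta_k^t(\lambda)) \ge \max\left\{\frac{r-1}{k+1}+1,\ r-\frac{r(r-1)(r-3)}{2r(k+1)+(r-1)(r-2)}\right\}. \] If \[ k \le \frac{2(r-1)}{d+\sqrt{d^2+4(2r-1)d+4}} - 1, \] then $w_n^*(\Theta_k^t(\lambda)) = \frac{r-1}{k+1}$ and $w_n(\Theta_k^t(\lambda)) = \frac{r-1}{k+1}+1$ for all integers $2\le n\le d$. If \[ 2rd \le \left(r-2-\frac{r(r-1)(r-4)}{2r(k+1)+(r-1)(r-2)}\right)\left(r-d-\frac{r(r-1)(r-4)}{2r(k+1)+(r-1)(r-2)}\right),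 \] then for all integers $2\le n\le d$, \[ w_n^*(\Theta_k^t(\lambda)) = r-1-\frac{r(r-1)(r-4)}{2r(k+1)+(r-1)(r-2)},\qquad w_n(\Theta_k^t(\lambda)) = r-\frac{r(r-1)(r-3)}{2r(k+1)+(r-1)(r-2)}. \]
   Context: $\mathbb{F}_q((T^{-1}))$ is the field of Laurent series $\xi=\sum_{m\ge N} a_m T^{-m}$ ($a_m\in\mathbb{F}_q$) with absolute value $|\xi|=q^{-N}$ when $a_N\ne0$, $|0|=0$, extended uniquely to an algebraic closure. Every $\xi$ has a continued fraction expansion $[a_0,a_1,a_2,\dots]$ with $a_i\in\mathbb{F}_q[T]$ and $\deg_T a_m\ge1$ for $m\ge1$. For finite words $W,V$ of partial quotients, $W\bigoplus V$ (or simply writing them separated by commas) denotes concatenation, $W^{[n]}$ is $W$ repeated $n$ times ($W^{[0]}$ empty), and $\bigoplus_{i\ge1}W_i$ is the infinite concatenation $W_1 W_2\cdots$. The height $H(P)$ of $P\in(\mathbb{F}_q[T])[X]$ is the maximum absolute value of its coefficients. For $\alpha$ algebraic over $\mathbb{F}_q(T)$, its minimal polynomial is the unique non-constant irreducible primitive $P\in(\mathbb{F}_q[T])[X]$ with leading coefficient monic in $T$ and $P(\alpha)=0$; $H(\alpha):=H(P)$, $\deg\alpha:=\deg P$. For $n\ge1$, $w_n(\xi)$ is the supremum of real $w$ with $0<|P(\xi)|\le H(P)^{-w}$ for infinitely many $P\in(\mathbb{F}_q[T])[X]$ of degree $\le n$, and $w_n^*(\xi)$ is the supremum of real $w^*$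 with $0<|\xi-\alpha|\le H(\alpha)^{-w^*-1}$ for infinitely many algebraic $\alpha$ of degree $\le n$. *)

(* Defs.v *)
From HB Require Import structures.
From mathcomp Require Import all_boot all_order all_algebra.
From mathcomp Require Import all_classical all_reals all_analysis.
Set Implicit Arguments. Unset Strict Implicit. Unset Printing Implicit Defensive.
Import Order.TTheory GRing.Theory Num.Theory.
Local Open Scope ring_scope.
Local Open Scope classical_set_scope.

Section Setting.
Variables (R : realType) (F : finFieldType) (L : closedFieldType).
Variables (q : nat) (iF : {rmorphism F -> L}) (Tl : L) (abs : L -> R).

(* |.| is a non-archimedean absolute value on the algebraically closed field L
   extending the T^{-1}-adic absolute value of F_q(T) (|T| = q, |c| = 1 for nonzero c in F). *)
Definition is_ext_abs : Prop :=
  (forall x, 0 <= abs x) /\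
  [/\ (forall x, abs x = 0 <-> x = 0),
      (forall x y, abs (x * y) = abs x * abs y),
      (forall x y, abs (x + y) <= Num.max (abs x) (abs y)),
      (forall c : F, c != 0 -> abs (iF c) = 1)
    & abs Tl = q%:R].

Definition tev (a : {poly F}) : L := (map_poly iF a).[Tl].

Definition pev (P : {poly {poly F}}) (x : L) : L := (map_poly tev P).[x].

Definition pabs (a : {poly F}) : R :=
  if a == 0 then 0 else (q%:R) ^+ (size a).-1.

Definition height (P : {poly {poly F}}) : R :=
  \big[Num.max/0]_(i < size P) pabs P`_i.

Definition primitive_poly (P : {poly {poly F}}) : Prop :=
  forall d : {poly F}, (forall i, (d %| P`_i)%R) -> size d = 1%N.

(* P is the minimal polynomial of alpha over F(T) (normalized in F[T][X]) *)
Definition is_minpoly (alpha : L) (P : {poly {poly F}}) : Prop :=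
  [/\ (1 < size P)%N, irreducible_poly P, primitive_poly P,
      lead_coef P \is monic & pev P alpha = 0].

Definition w_exp (n : nat) (xi : L) : \bar R :=
  ereal_sup [set w%:E | w in
    [set w : R | infinite_set [set P : {poly {poly F}} |
        (size P <= n.+1)%N /\ 0 < abs (pev P xi) <= powR (height P) (- w)]]].

Definition wstar_exp (n : nat) (xi : L) : \bar R :=
  ereal_sup [set w%:E | w in
    [set w : R | infinite_set [set alpha : L | exists P,
        [/\ is_minpoly alpha P, (size P <= n.+1)%N &
            0 < abs (xi - alpha) <= powR (height P) (- w - 1)]]]].
End Setting.

(* numerators / denominators of the convergents of [a_0, a_1, ...];
   cf_pq a n = (p_n, p_{n-1}) and (q_n, q_{n-1}) *)
Fixpoint cf_pq (F : fieldType) (a : nat -> {poly F}) (n : nat)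
  : ({poly F} * {poly F}) * ({poly F} * {poly F}) :=
  match n with
  | 0 => ((a 0%N, 1), (1, 0))
  | n'.+1 => let: ((p, p'), (q, q')) := cf_pq a n' in
             ((a n * p + p', p), (a n * q + q', q))
  end.
Definition cf_num (F : fieldType) (a : nat -> {poly F}) n := (cf_pq a n).1.1.
Definition cf_den (F : fieldType) (a : nat -> {poly F}) n := (cf_pq a n).2.1.

Definition cf_value (R : realType) (F : finFieldType) (L : closedFieldType)
  (iF : {rmorphism F -> L}) (Tl : L) (abs : L -> R)
  (a : nat -> {poly F}) (xi : L) : Prop :=
  forall e : R, 0 < e -> exists N : nat, forall n : nat, (N <= n)%N ->
    abs (xi - tev iF Tl (cf_num a n) / tev iF Tl (cf_den a n)) < e.

(* infinite word: prefix followed by the infinite concatenation W 1 W 2 ...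
   (each W i nonempty); the n-th partial quotient *)
Definition inf_word (A : Type) (x0 : A) (pre : seq A) (W : nat -> seq A)
  (n : nat) : A :=
  nth x0 (pre ++ flatten [seq W i | i <- iota 1 n.+1]) n.

Definition theta_block (F : finFieldType) (p r k : nat) (lam : F) (i : nat)
  : seq {poly F} :=
  let mu := 2 - lam in
  if p != 2%N then
    flatten (nseq k.+1
      ('X :: flatten (nseq ((r ^ i - 1) %/ 2) [:: lam *: 'X; mu *: 'X])))
  else
    flatten (nseq k.+1 ('X :: nseq (r ^ i - 1) (lam *: 'X))).

Definition theta_pq (F : finFieldType) (p r k : nat) (lam : F) : nat -> {poly F} :=
  inf_word 0 (0 :: nseq k 'X) (theta_block p r k lam).

(* Main.v *)
(** A partial quotient [c *: 'X] with [c] nonzero is recorded as the letter [c], so that the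
    expansion of Theta is a word over F: after [k] letters 1 come [k+1] copies of
    W_i = 1 (lam mu)^((r^i-1)/2) for i = 1, 2, ... (W_i = 1 lam^(r^i-1) when p = 2).

    Two families of quadratic irrationals approximate Theta very well.  The first follows the
    expansion up to the first letter 1 of block i and then continues with the period
    (lam mu).  The second follows the expansion up to the last letter 1 of block i-1 and then
    continues periodically with a rotation of W_i; starting the period that early, instead of
    at the beginning of block i, is what makes the height as small as possible.  Counting
    letters gives the height H of each of these numbers, its distance H^(-1-A) to Theta and
    the distance of its conjugate, up to bounded factors, hence all the lower bounds.

    For the upper bounds, let P have degree at most d.  If P does not vanish at the roots
    al, al' of a member of the family with leading coefficient a, then a^d P(al) P(al') has
    absolute value at least 1, being a nonzero element of F[T]; choosing the first member of
    the family that is close enough to Theta, this bounds |P(Theta)| from below by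
    H(P)^(-A), thanks to the numerical condition relating d and A.  Otherwise the quadratic
    polynomial divides P by Gauss's lemma, and one concludes by induction on the degree. *)

Require Import Defs.
From HB Require Import structures.
From mathcomp Require Import all_boot all_order all_algebra.
From mathcomp Require Import all_classical all_reals all_analysis.
From mathcomp Require Import zify ring lra.
Set Implicit Arguments.
Unset Strict Implicit.
Unset Printing Implicit Defensive.
Import Order.TTheory GRing.Theory Num.Theory.
Local Open Scope ring_scope.

(** * Absolute values and heights *)

Section Tev.
Variables (F : finFieldType) (L : closedFieldType) (iF : {rmorphism F -> L}) (Tl : L).

Fact tev_zmod_morphism : zmod_morphism (tev iF Tl).
Proof. by move=> a b; rewrite /tev rmorphB hornerD hornerN. Qed.

Fact tev_monoid_morphism : monoid_morphism (tev iF Tl).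
Proof.
by split=> [|a b]; rewrite /tev ?rmorph1 ?rmorphM ?hornerM ?hornerC.
Qed.

HB.instance Definition _ :=
  GRing.isZmodMorphism.Build {poly F} L (tev iF Tl) tev_zmod_morphism.
HB.instance Definition _ :=
  GRing.isMonoidMorphism.Build {poly F} L (tev iF Tl) tev_monoid_morphism.

Lemma tevC c : tev iF Tl c%:P = iF c.
Proof. by rewrite /tev map_polyC hornerC. Qed.

Lemma tevX : tev iF Tl 'X = Tl.
Proof. by rewrite /tev map_polyX hornerX. Qed.

Lemma tevZ c a : tev iF Tl (c *: a) = iF c * tev iF Tl a.
Proof. by rewrite -mul_polyC rmorphM /= tevC. Qed.

Lemma pevD P1 P2 x : pev iF Tl (P1 + P2) x = pev iF Tl P1 x + pev iF Tl P2 x.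
Proof. by rewrite /pev rmorphD hornerD. Qed.

Lemma pevM P1 P2 x : pev iF Tl (P1 * P2) x = pev iF Tl P1 x * pev iF Tl P2 x.
Proof. by rewrite /pev rmorphM hornerM. Qed.

Lemma pevC a x : pev iF Tl a%:P x = tev iF Tl a.
Proof. by rewrite /pev map_polyC hornerC. Qed.

Lemma pevX x : pev iF Tl 'X x = x.
Proof. by rewrite /pev map_polyX hornerX. Qed.

Lemma pevMXaddC P a x : pev iF Tl (P * 'X + a%:P) x = pev iF Tl P x * x + tev iF Tl a.
Proof. by rewrite pevD pevM pevX pevC. Qed.

Lemma pev0 x : pev iF Tl 0 x = 0.
Proof. by rewrite /pev map_poly0 horner0. Qed.

End Tev.

Section Abs.
Variables (R : realType) (F : finFieldType) (L : closedFieldType).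
Variables (q : nat) (iF : {rmorphism F -> L}) (Tl : L) (abs : L -> R).
Hypotheses (Habs : is_ext_abs q iF Tl abs) (q_gt1 : (1 < q)%N).

Local Notation Q := (q%:R : R).
Local Notation tev := (tev iF Tl).
Local Notation pev := (pev iF Tl).

Lemma Q_gt1 : 1 < Q. Proof. by rewrite ltr1n. Qed.
Lemma Q_gt0 : 0 < Q. Proof. exact: lt_trans ltr01 Q_gt1. Qed.
Lemma Q_neq0 : Q != 0. Proof. exact: lt0r_neq0 Q_gt0. Qed.

Lemma abs_ge0 x : 0 <= abs x. Proof. by case: Habs. Qed.
Lemma abs_eq0 x : (abs x == 0) = (x == 0).
Proof. by case: Habs => _ [H _ _ _ _]; apply/eqP/eqP => /H. Qed.
Lemma abs0 : abs 0 = 0. Proof. by apply/eqP; rewrite abs_eq0. Qed.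
Lemma absM x y : abs (x * y) = abs x * abs y.
Proof. by case: Habs => _ [_ H _ _ _]. Qed.
Lemma abs_iF c : c != 0 -> abs (iF c) = 1.
Proof. by case: Habs => _ [_ _ _ H _]; apply: H. Qed.
Lemma absT : abs Tl = Q. Proof. by case: Habs => _ [_ _ _ _ H]. Qed.
Lemma absD_max x y : abs (x + y) <= Num.max (abs x) (abs y).
Proof. by case: Habs => _ [_ _ H _ _]; apply: H. Qed.
Lemma abs1 : abs 1 = 1. Proof. by rewrite -(rmorph1 iF) abs_iF ?oner_eq0. Qed.
Lemma absN x : abs (- x) = abs x.
Proof.
by rewrite -mulN1r absM -(rmorphN1 iF) abs_iF ?mul1r // oppr_eq0 oner_eq0.
Qed.
Lemma abs_gt0 x : (0 < abs x) = (x != 0).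
Proof. by rewrite lt0r abs_eq0 abs_ge0 andbT. Qed.
Lemma absV x : abs x^-1 = (abs x)^-1.
Proof.
have [->|x0] := eqVneq x 0; first by rewrite invr0 abs0 invr0.
have ax0 : abs x != 0 by rewrite abs_eq0.
by apply: (mulfI ax0); rewrite -absM mulfV // mulfV // abs1.
Qed.
Lemma absX x n : abs (x ^+ n) = abs x ^+ n.
Proof. by elim: n => [|n IH]; rewrite ?expr0 ?abs1 // !exprS absM IH. Qed.

Lemma absD_le x y (b : R) : abs x <= b -> abs y <= b -> abs (x + y) <= b.
Proof. by move=> xb yb; apply: le_trans (absD_max _ _) _; rewrite ge_max xb. Qed.

Lemma absB_le x y (b : R) : abs x <= b -> abs y <= b -> abs (x - y) <= b.
Proof. by move=> xb yb; rewrite absD_le ?absN. Qed.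

Lemma absD_eq x y : abs x < abs y -> abs (x + y) = abs y.
Proof.
move=> xy; apply/le_anti/andP; split; first by rewrite absD_le // ltW.
rewrite leNgt; apply/negP => lt.
suff: abs y < abs y by rewrite ltxx.
have {1}-> : abs y = abs ((x + y) - x) by congr abs; ring.
by apply: le_lt_trans (absD_max _ _) _; rewrite absN gt_max lt.
Qed.

Lemma absB_eq x y : abs (x - y) < abs y -> abs x = abs y.
Proof. by move=> H; rewrite -(absD_eq H) subrK. Qed.

(** Horner induction: when [a] is nonzero, [a * T] has absolute value at least [Q > 1], so it
    dominates the constant added at each step. *)
Lemma abs_tev a : a != 0 -> abs (tev a) = Q ^+ (size a).-1.
Proof.
elim/poly_ind: a => [|a c IH]; first by rewrite eqxx.
rewrite rmorphD rmorphM /= tevX tevC.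
have [->|a0] := eqVneq a 0.
  rewrite mul0r add0r rmorph0 mul0r add0r polyC_eq0 => c0.
  by rewrite abs_iF // size_polyC c0.
move=> _; rewrite size_MXaddC (negbTE a0) /=.
have Ha : abs (tev a * Tl) = Q ^+ size a.
  by rewrite absM absT IH // -exprSr prednK // size_poly_gt0.
have [->|c0] := eqVneq c 0; first by rewrite rmorph0 addr0.
rewrite addrC absD_eq // Ha abs_iF // exprn_egt1 ?Q_gt1 //.
by rewrite size_poly_eq0.
Qed.

Lemma tev_eq0 a : (tev a == 0) = (a == 0).
Proof.
apply/eqP/eqP => [|->]; last by rewrite rmorph0.
have [->//|a0] := eqVneq a 0 => /eqP; rewrite -abs_eq0 abs_tev //.
by rewrite expf_eq0 (negbTE Q_neq0) andbF.
Qed.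

Lemma abs_tev_ge1 a : a != 0 -> 1 <= abs (tev a).
Proof. by move=> /abs_tev->; rewrite exprn_ege1 // ltW // Q_gt1. Qed.

Lemma size_tevP a n : (abs (tev a) == Q ^+ n) = (size a == n.+1).
Proof.
have [->|a0] := eqVneq a 0.
  by rewrite rmorph0 abs0 size_poly0 eq_sym expf_eq0 (negbTE Q_neq0) andbF.
rewrite abs_tev // eq_le !ler_eXn2l ?Q_gt1 // -eqn_leq.
by rewrite -[in RHS](prednK (_ : 0 < size a)%N) ?size_poly_gt0.
Qed.

Lemma pev_le (P : {poly {poly F}}) x (b : R) : abs x <= 1 -> 0 <= b ->
  (forall i, abs (tev P`_i) <= b) -> abs (pev P x) <= b.
Proof.
move=> x1 b0; elim/poly_ind: P => [_|P c IH Pb]; first by rewrite pev0 abs0.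
rewrite pevMXaddC absD_le //; last by have := Pb 0; rewrite coefD coefMX coefC add0r.
rewrite absM -[leRHS]mulr1 ler_pM ?abs_ge0 //; apply: IH => i.
by have := Pb i.+1; rewrite coefD coefMX coefC addr0.
Qed.

(** Horner's scheme writes the difference as [(P x - P y) x + P y (x - y)]. By the ultrametric
    inequality the constant remains the coefficient bound [b], with no factor from the degree. *)
Lemma pev_lip (P : {poly {poly F}}) x y (b : R) : abs x <= 1 -> abs y <= 1 -> 0 <= b ->
  (forall i, abs (tev P`_i) <= b) ->
  abs (pev P x - pev P y) <= b * abs (x - y).
Proof.
move=> x1 y1 b0; elim/poly_ind: P => [_|P c IH Pb].
  by rewrite !pev0 subr0 abs0 mulr_ge0 ?abs_ge0.
have Pb' i : abs (tev P`_i) <= b.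
  by have := Pb i.+1; rewrite coefD coefMX coefC addr0.
rewrite !pevMXaddC.
have -> : pev P x * x + tev c - (pev P y * y + tev c)
   = (pev P x - pev P y) * x + pev P y * (x - y) by ring.
apply: absD_le; rewrite absM.
  by rewrite -[leRHS]mulr1 ler_pM ?abs_ge0 //; apply: IH.
by rewrite ler_wpM2r ?abs_ge0 // pev_le.
Qed.

(* logarithm of the height in base q *)
Definition lheight (P : {poly {poly F}}) : nat := \max_(i < size P) (size (P`_i)%R).-1.

Lemma heightE P : P != 0 -> height R q P = Q ^+ lheight P.
Proof.
move=> P0; rewrite /height /lheight.
apply/le_anti/andP; split.
  apply: bigmax_le => [|i _]; first by rewrite exprn_ge0 // ltW // Q_gt0.
  rewrite /pabs; case: eqP => _; first by rewrite exprn_ge0 // ltW // Q_gt0.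
  by rewrite ler_weXn2l ?ltW ?Q_gt1 // (leq_bigmax i).
have sP : (0 < size P)%N by rewrite size_poly_gt0.
have [i Ei] : {i : 'I_(size P) | \max_(i < size P) (size (P`_i)%R).-1 = (size P`_i).-1}.
  by apply: bigop.eq_bigmax; rewrite card_ord.
(* The maximal exponent may be reached at a zero coefficient, since [(size 0).-1 = 0]. The exponent
   is then 0, and the leading coefficient supplies the bound 1. *)
rewrite Ei; have [Pi0|Pi0] := eqVneq P`_i 0.
  have lP0 : P`_(size P).-1 != 0 by rewrite -lead_coefE lead_coef_eq0.
  have lt : ((size P).-1 < size P)%N by rewrite prednK.
  apply: le_trans (le_bigmax _ _ (Ordinal lt)) => /=.
  by rewrite Pi0 size_poly0 expr0 /pabs (negbTE lP0) exprn_ege1 // ltW // Q_gt1.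
by apply: le_trans (le_bigmax _ _ i); rewrite /pabs (negbTE Pi0).
Qed.

Lemma abs_coef_le (P : {poly {poly F}}) i : abs (tev P`_i) <= Q ^+ lheight P.
Proof.
have [Pi|Pi] := eqVneq P`_i 0.
  by rewrite Pi rmorph0 abs0 exprn_ge0 // ltW // Q_gt0.
have iP : (i < size P)%N by rewrite ltnNge; apply: contraNN Pi => /leq_sizeP->.
rewrite abs_tev // ler_weXn2l ?ltW ?Q_gt1 //.
exact: (leq_bigmax (Ordinal iP)).
Qed.

Lemma lheight_le (P : {poly {poly F}}) n : (forall i, abs (tev P`_i) <= Q ^+ n) -> (lheight P <= n)%N.
Proof.
move=> H; apply/bigmax_leqP => i _; have [->|Pi] := eqVneq P`_i 0.
  by rewrite size_poly0.
by have := H i; rewrite abs_tev // ler_eXn2l ?Q_gt1.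
Qed.

End Abs.

(** * Continuants and quadratic approximations *)

Section Continuants.
Variable F : fieldType.
Implicit Types (c : F) (u v w : seq F).

Definition letter_mx c : 'M[{poly F}]_2 :=
  \matrix_(i, j) (if i == 0 then (if j == 0 then c *: 'X else 1) else (j == 0)%:R).

(* A letter [c] stands for the partial quotient [c *: 'X]. *)
Definition word_mx w : 'M[{poly F}]_2 := \prod_(c <- w) letter_mx c.

Lemma mulmx2E (A B : 'M[{poly F}]_2) i j :
  (A * B) i j = A i 0 * B 0 j + A i 1 * B 1 j.
Proof.
rewrite -mulmxE mxE !big_ord_recl big_ord0 addr0.
by have -> : lift ord0 ord0 = 1 :> 'I_2 by apply: val_inj.
Qed.

Lemma word_mx_nil i j : word_mx [::] i j = (i == j)%:R.
Proof. by rewrite /word_mx big_nil mxE. Qed.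

Lemma word_mx_cat u v i j :
  word_mx (u ++ v) i j = word_mx u i 0 * word_mx v 0 j + word_mx u i 1 * word_mx v 1 j.
Proof. by rewrite /word_mx big_cat mulmx2E. Qed.

Lemma word_mx_cons0 c w j :
  word_mx (c :: w) 0 j = c *: 'X * word_mx w 0 j + word_mx w 1 j.
Proof. by rewrite /word_mx big_cons mulmx2E !mxE /= mul1r. Qed.

Lemma word_mx_cons1 c w j : word_mx (c :: w) 1 j = word_mx w 0 j.
Proof. by rewrite /word_mx big_cons mulmx2E !mxE /= mul1r mul0r addr0. Qed.

Definition word_mx_cons := (word_mx_cons0, word_mx_cons1).

Lemma word_mx_rcons0 c w i :
  word_mx (rcons w c) i 0 = word_mx w i 0 * (c *: 'X) + word_mx w i 1.
Proof. by rewrite -cats1 word_mx_cat !word_mx_cons !word_mx_nil /= mulr1 addr0 mulr1. Qed.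

Lemma word_mx_rcons1 c w i : word_mx (rcons w c) i 1 = word_mx w i 0.
Proof. by rewrite -cats1 word_mx_cat !word_mx_cons !word_mx_nil /= mulr0 add0r mulr1 mulr0 addr0. Qed.

Definition word_mx_rcons := (word_mx_rcons0, word_mx_rcons1).

Lemma word_mx_det w :
  word_mx w 0 0 * word_mx w 1 1 - word_mx w 0 1 * word_mx w 1 0 = (-1) ^+ size w.
Proof.
elim: w => [|c w IH]; first by rewrite !word_mx_nil /= mulr1 mulr0 subr0.
by rewrite !word_mx_cons /= exprS -IH; ring.
Qed.

Lemma ord2P (P : 'I_2 -> Prop) : P 0 -> P 1 -> forall i, P i.
Proof.
move=> P0 P1; case=> -[|[|//]] Hi.
  by rewrite (_ : Ordinal Hi = 0) //; apply: val_inj.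
by rewrite (_ : Ordinal Hi = 1) //; apply: val_inj.
Qed.

(** The matrix of a letter is symmetric, so transposing the product reverses the word. *)
Lemma word_mx_rev w i j : word_mx (rev w) i j = word_mx w j i.
Proof.
elim: w i j => [|c w IH] i j; first by rewrite !word_mx_nil eq_sym.
rewrite rev_cons; elim/ord2P: j; rewrite !word_mx_rcons !word_mx_cons !IH //.
by rewrite mulrC.
Qed.

Lemma size_mulX_add c (p r : {poly F}) : c != 0 -> (size r <= size p)%N ->
  p != 0 -> size (c *: 'X * p + r) = (size p).+1.
Proof.
move=> c0 rp p0; have E : size (c *: 'X * p) = (size p).+1.
  by rewrite -scalerAl size_scale // mulrC size_mulX.
by rewrite size_polyDl E // ltnS.
Qed.

Lemma size_word_mx_col0 w : 0 \notin w ->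
  size (word_mx w 0 0) = (size w).+1 /\ size (word_mx w 1 0) = size w.
Proof.
elim: w => [_|c w IH]; first by rewrite !word_mx_nil /= size_poly1 size_poly0.
rewrite inE negb_or eq_sym => /andP[c0 /IH[IH0 IH1]].
rewrite !word_mx_cons; split; last exact: IH0.
rewrite size_mulX_add ?IH0 ?IH1 //.
by rewrite -size_poly_eq0 IH0.
Qed.

Lemma size_word_mx_01 w : 0 \notin w -> size (word_mx w 0 1) = size w.
Proof.
move=> w0; rewrite -word_mx_rev; have := @size_word_mx_col0 (rev w).
by rewrite mem_rev size_rev => /(_ w0)[].
Qed.

Lemma size_word_mx_11 w : 0 \notin w -> w != [::] ->
  size (word_mx w 1 1) = (size w).-1.
Proof.
case: w => // c w; rewrite inE negb_or => /andP[_ w0] _.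
by rewrite word_mx_cons1 size_word_mx_01.
Qed.

(** As the partial quotient of index 0 vanishes, denominators are read in row 0 and numerators in
    row 1. The word starts at the partial quotient of index 1. *)
Lemma cf_pq_word (a : nat -> {poly F}) (c : nat -> F) n :
  a 0%N = 0 -> (forall i, a i.+1 = c i *: 'X) ->
  let M := word_mx (mkseq c n) in cf_pq a n = ((M 1 0, M 1 1), (M 0 0, M 0 1)).
Proof.
move=> a0 ac; elim: n => [|n IH] /=; first by rewrite !word_mx_nil a0.
by rewrite IH mkseqS !word_mx_rcons ac !(mulrC (c n *: 'X)).
Qed.

End Continuants.

(** * Quadratic irrationals with a prescribed period *)

Section Approximation.
Variables (R : realType) (F : finFieldType) (L : closedFieldType).
Variables (q : nat) (iF : {rmorphism F -> L}) (Tl : L) (abs : L -> R).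
Hypotheses (Habs : is_ext_abs q iF Tl abs) (q_gt1 : (1 < q)%N).

Local Notation Q := (q%:R : R).
Local Notation tev := (tev iF Tl).
Local Notation pev := (pev iF Tl).
Local Notation lt := (fun c => iF c * Tl).
Local Notation mx := (fun w i j => tev (word_mx w i j)).
Let Q1 : 1 < Q := Q_gt1 R q_gt1.
Let Q0 : 0 < Q := Q_gt0 R q_gt1.
Let Qn0 : Q != 0 := Q_neq0 R q_gt1.

Implicit Types (u v w : seq F) (x y z : L).

(** The value of the continued fraction whose partial quotients are the letters of [w] and whose
    last complete quotient is [y]. *)
Fixpoint mob w y : L :=
  if w is c :: w' then iF c * Tl + (mob w' y)^-1 else y.

Lemma mob_cat u v y : mob (u ++ v) y = mob u (mob v y).
Proof. by elim: u => //= c u ->. Qed.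

Lemma abs_neq0 x : abs x = Q -> x != 0.
Proof. by move=> xQ; rewrite -(abs_eq0 Habs) xQ. Qed.

Lemma abs_letter c z : c != 0 -> abs z < Q -> abs (lt c + z) = Q.
Proof.
move=> c0 zQ; have cQ : abs (lt c) = Q.
  by rewrite (absM Habs) (abs_iF Habs c0) mul1r (absT Habs).
by rewrite addrC (absD_eq Habs) cQ.
Qed.

Lemma absVQ y : abs y = Q -> abs y^-1 = Q^-1.
Proof. by move=> yQ; rewrite (absV Habs) yQ. Qed.

Lemma QV_lt : Q^-1 < Q.
Proof. by apply: lt_trans Q1; rewrite invf_lt1. Qed.

Lemma abs_mob w y : 0 \notin w -> abs y = Q -> abs (mob w y) = Q.
Proof.
elim: w => //= c w IH; rewrite inE negb_or eq_sym => /andP[c0 w0] yQ.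
by rewrite abs_letter // absVQ ?QV_lt // IH.
Qed.

Lemma abs_subV y z : abs y = Q -> abs z = Q -> abs (y^-1 - z^-1) * Q ^+ 2 = abs (y - z).
Proof.
move=> yQ zQ; have y0 := abs_neq0 yQ; have z0 := abs_neq0 zQ.
have -> : y - z = - (y^-1 - z^-1) * y * z by field; rewrite y0 z0.
by rewrite !(absM Habs) (absN Habs) yQ zQ; ring.
Qed.

(** Each letter costs one inversion of complete quotients of absolute value [Q], which divides
    distances by [Q ^+ 2]. Counting common letters thus gives exact distances. *)
Lemma mob_diff w y z : 0 \notin w -> abs y = Q -> abs z = Q ->
  abs (mob w y - mob w z) * Q ^+ (2 * size w) = abs (y - z).
Proof.
move=> + yQ zQ; elim: w => /= [_|c w IH]; first by rewrite mulr1.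
rewrite inE negb_or eq_sym => /andP[c0 w0].
have -> : lt c + (mob w y)^-1 - (lt c + (mob w z)^-1) = (mob w y)^-1 - (mob w z)^-1.
  by ring.
by rewrite mulnS exprD mulrA abs_subV ?abs_mob // IH.
Qed.

(* The denominator below is the product of the complete quotients of [mob w y]. *)
Lemma mob_mx w y : 0 \notin w -> abs y = Q ->
  abs (mx w 1 0 * y + mx w 1 1) = Q ^+ size w /\
  mob w y * (mx w 1 0 * y + mx w 1 1) = mx w 0 0 * y + mx w 0 1.
Proof.
move=> + yQ; elim: w => [_|c w IH].
  by rewrite !word_mx_nil /= !rmorph0 !rmorph1 mul0r add0r (abs1 Habs) mul1r addr0 mulr1.
rewrite inE negb_or eq_sym => /andP[c0 w0]; have [IH1 IH2] := IH w0.
have mQ := abs_mob w0 yQ; have m0 := abs_neq0 mQ.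
rewrite !word_mx_cons /= !rmorphD !rmorphM /= tevZ tevX -IH2; split.
  by rewrite (absM Habs) IH1 mQ exprS.
rewrite mulrDl mulKf // {1}IH2; ring.
Qed.

(** If [f + g x = 0] with [g] nonzero and [x] starts with [u], the determinant of [word_mx u] gives
    the polynomial [M10 f + M00 g] the absolute value [|g| / Q^|u|]. It is nonzero, but for long [u]
    this value is below 1. *)
Lemma mob_irrational x :
  (forall N, exists u y, [/\ (N <= size u)%N, 0 \notin u, abs y = Q & x = mob u y]) ->
  forall f g : {poly F}, tev f + tev g * x = 0 -> g = 0.
Proof.
move=> Hx f g fg; have [//|g0] := eqVneq g 0.
have [u [y [su u0 yQ xE]]] := Hx (size g).
have [D1 D2] := mob_mx u0 yQ.
have Dn0 : mx u 1 0 * y + mx u 1 1 != 0.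
  by rewrite -(abs_eq0 Habs) D1 expf_neq0.
have E : tev (word_mx u 1 0 * f + word_mx u 0 0 * g) * (mx u 1 0 * y + mx u 1 1)
         = (-1) ^+ size u * tev g.
  have fE : tev f = - (tev g * mob u y) by rewrite -xE; apply/eqP; rewrite -addr_eq0 fg.
  rewrite -(rmorphN1 tev) -rmorphXn /= -(word_mx_det u) !rmorphD rmorphN !rmorphM /= fE.
  transitivity (- (mx u 1 0 * tev g) * (mob u y * (mx u 1 0 * y + mx u 1 1))
     + mx u 0 0 * tev g * (mx u 1 0 * y + mx u 1 1)); first by ring.
  by rewrite D2; ring.
have /(congr1 abs) := E.
rewrite !(absM Habs) D1 (absX Habs) (absN Habs) (abs1 Habs) expr1n mul1r.
rewrite [in RHS](abs_tev Habs) // => E2.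
have h0 : word_mx u 1 0 * f + word_mx u 0 0 * g != 0.
  apply/eqP => h0; move/eqP: E2; rewrite h0 rmorph0 (abs0 Habs) mul0r.
  by rewrite eq_sym expf_eq0 (negbTE Qn0) andbF.
have h1 := abs_tev_ge1 Habs q_gt1 h0.
have : Q ^+ size u <= Q ^+ (size g).-1.
  by rewrite -E2 ler_peMl // exprn_ge0 // ltW.
rewrite ler_eXn2l // => H; have : (0 < size g)%N by rewrite size_poly_gt0.
by lia.
Qed.

Lemma quadratic_split (a b c : L) : a != 0 ->
  exists z1 z2, b = - a * (z1 + z2) /\ c = a * z1 * z2.
Proof.
move=> a0.
have [z Hz] := solve_monicpoly (fun i => if i == 0%N then - c / a else - b / a) (isT : (0 < 2)%N).
rewrite !big_ord_recl big_ord0 /= addr0 expr0 mulr1 expr1 in Hz.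
exists z, (- b / a - z); split; first by field.
have -> : a * z * (- b / a - z) = - b * z - a * z ^+ 2 by field.
by rewrite Hz; field.
Qed.

(** Newton polygon of [a X^2 + b X + c]: the product of the roots has absolute value 1 and their sum
    has absolute value [Q]. Two roots of absolute value 1 could not have such a sum, so the larger
    root dominates it. *)
Lemma quadratic_split_abs (a b c : L) : abs a = abs c -> abs b = Q * abs a -> a != 0 ->
  exists z1 z2, [/\ b = - a * (z1 + z2), c = a * z1 * z2, abs z1 = Q & abs z2 = Q^-1].
Proof.
move=> ac ba a0; have [z1 [z2 [Eb Ec]]] := quadratic_split b c a0.
have A0 : abs a != 0 by rewrite (abs_eq0 Habs).
have S : abs (z1 + z2) = Q.
  by apply: (mulfI A0); rewrite mulrC [in RHS]mulrC -ba Eb (absM Habs) (absN Habs) mulrC.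
have P : abs z1 * abs z2 = 1.
  by apply: (mulfI A0); rewrite mulr1 mulrA -!(absM Habs) -Ec.
have key x y : abs (x + y) = Q -> abs x * abs y = 1 -> abs y <= abs x -> abs x = Q /\ abs y = Q^-1.
  move=> xy p yx; have y0 : abs y != 0.
    by apply/eqP => y0; move: p; rewrite y0 mulr0 => /eqP; rewrite eq_sym oner_eq0.
  suff xQ : abs x = Q.
    by split => //; apply: (mulfI Qn0); rewrite -{1}xQ p divff.
  have [E|lt] : abs y = abs x \/ abs y < abs x.
    by move: yx; rewrite le_eqVlt => /orP[/eqP|]; [left|right].
    have x1 : abs x <= 1.
      rewrite leNgt; apply/negP => x1; move: p; rewrite E => p.
      by have : 1 < abs x * abs x; [rewrite -[ltLHS]mulr1 ltr_pM | rewrite p ltxx].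
    by have := absD_le Habs x1 (_ : abs y <= 1); rewrite xy E => /(_ x1); rewrite leNgt Q1.
  by rewrite -xy addrC (absD_eq Habs).
have [le|/ltW le] := lerP (abs z2) (abs z1).
  by exists z1, z2; have [] := key _ _ S P le.
have [Z2 Z1] : abs z2 = Q /\ abs z1 = Q^-1 by apply: key; rewrite // 1?addrC // mulrC.
by exists z2, z1; split; rewrite // 1?(addrC z2) // mulrAC.
Qed.

Lemma abs_tev_size (a : {poly F}) n : size a = n.+1 -> abs (tev a) = Q ^+ n.
Proof. by move=> /eqP; rewrite -(size_tevP Habs) // => /eqP. Qed.

Lemma abs_tev_size_le (a : {poly F}) n : (size a <= n.+1)%N -> abs (tev a) <= Q ^+ n.
Proof.
move=> sa; have [->|a0] := eqVneq a 0.
  by rewrite rmorph0 (abs0 Habs) exprn_ge0 // ltW.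
by rewrite (abs_tev Habs) // ler_eXn2l // -ltnS prednK ?size_poly_gt0.
Qed.

Lemma fixed_points v : 0 \notin v -> (2 <= size v)%N -> exists b b',
  [/\ abs b = Q, abs b' = Q^-1, mx v 1 1 - mx v 0 0 = - mx v 1 0 * (b + b'),
      - mx v 0 1 = mx v 1 0 * b * b' & mob v b = b].
Proof.
move=> v0 sv; have [s00 s10] := size_word_mx_col0 v0.
have s01 := size_word_mx_01 v0.
have s11 : size (word_mx v 1 1) = (size v).-1.
  by rewrite size_word_mx_11 //; case: (v) sv.
case: (size v) sv s00 s10 s01 s11 => [|[|n]] //= _ s00 s10 s01 s11.
have a00 := abs_tev_size s00; have a10 := abs_tev_size s10; have a01 := abs_tev_size s01.
have a11 := abs_tev_size s11.
have [|||b [b' [H1 H2 bQ b'Q]]] :=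
    @quadratic_split_abs (mx v 1 0) (mx v 1 1 - mx v 0 0) (- mx v 0 1).
- by rewrite (absN Habs) a10 a01.
- rewrite (absD_eq Habs) (absN Habs) a00 ?a10 -?exprS // a11.
  by rewrite ltr_eXn2l.
- by rewrite -(abs_eq0 Habs) a10 expf_neq0.
exists b, b'; split=> //.
have [D1 D2] := mob_mx v0 bQ.
have D0 : mx v 1 0 * b + mx v 1 1 != 0 by rewrite -(abs_eq0 Habs) D1 expf_neq0.
apply: (mulIf D0); rewrite D2.
have -> : mx v 0 1 = - (mx v 1 0 * b * b') by rewrite -H2 opprK.
have -> : mx v 0 0 = mx v 1 1 + mx v 1 0 * (b + b').
  by rewrite -[LHS](subKr (mx v 1 1)) H1 mulNr opprK.
by ring.
Qed.

(** Galois: [-1/b'] has the reversed period, hence starts with the last letter [c]. Only this first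
    letter is needed, and it is read off from the fixed point equation of [b']. *)
Lemma conj_last_letter v c b b' : 0 \notin rcons v c -> v != [::] ->
  abs b' = Q^-1 ->
  let M := mx (rcons v c) in
  M 1 1 - M 0 0 = - M 1 0 * (b + b') -> - M 0 1 = M 1 0 * b * b' ->
  abs (b'^-1 + lt c) < Q.
Proof.
move=> vc0 vN b'Q M H1 H2.
have b'0 : b' != 0 by rewrite -(abs_eq0 Habs) b'Q invr_eq0.
have v0 : 0 \notin v by move: vc0; rewrite mem_rcons inE negb_or => /andP[].
have [s00 s10] := size_word_mx_col0 v0.
have s01 := size_word_mx_01 v0.
have s11 := size_word_mx_11 v0 vN.
have sv : (0 < size v)%N by case: (v) vN.
have E : (b'^-1 + lt c) * mx v 0 0 = M 1 0 * b' + M 1 1 - mx v 0 1.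
  have E1 : M 0 0 * b' + M 0 1 = (M 1 0 * b' + M 1 1) * b'.
    have -> : M 0 1 = - (M 1 0 * b * b') by rewrite -H2 opprK.
    have -> : M 0 0 = M 1 1 + M 1 0 * (b + b').
      by rewrite -[LHS](subKr (M 1 1)) H1 mulNr opprK.
    by ring.
  apply: (mulIf b'0); rewrite mulrBl -E1 /M !word_mx_rcons rmorphD rmorphM /= tevZ tevX.
  by field.
have h00 := abs_tev_size s00.
have sv' : (size v).-1.+1 = size v by rewrite prednK.
have h1 : abs (M 1 0 * b' + M 1 1 - mx v 0 1) <= Q ^+ (size v).-1.
  apply: (absB_le Habs); last by apply: abs_tev_size_le; rewrite sv' s01.
  apply: (absD_le Habs); last by rewrite /M word_mx_rcons1; apply: abs_tev_size_le; rewrite sv' s10.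
  rewrite (absM Habs) b'Q ler_pdivrMr // -exprSr sv'.
  by apply: abs_tev_size_le; have [_ ->] := size_word_mx_col0 vc0; rewrite size_rcons.
move/(congr1 abs): E; rewrite (absM Habs) h00 => E.
have : abs (b'^-1 + lt c) * Q ^+ size v <= Q ^+ (size v).-1 by rewrite E.
rewrite -{1}sv' exprS mulrA -[leRHS]mul1r ler_pM2r ?exprn_gt0 // => H.
apply: le_lt_trans QV_lt; by rewrite -[leRHS]mul1r ler_pdivlMr.
Qed.

Lemma mob_power v b i : mob v b = b -> mob (flatten (nseq i v)) b = b.
Proof. by move=> H; elim: i => //= i IH; rewrite mob_cat IH. Qed.

Lemma notin_power v i : 0 \notin v -> 0 \notin flatten (nseq i v).
Proof. by move=> v0; elim: i => //= i IH; rewrite mem_cat negb_or v0. Qed.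

Lemma size_power v i : size (flatten (nseq i v)) = (i * size v)%N.
Proof. by elim: i => //= i IH; rewrite size_cat IH mulSn. Qed.

Lemma content_split (a b c : {poly F}) : a != 0 -> exists g a' b' c',
  [/\ a = g * a', b = g * b', c = g * c', a' \is monic &
    forall d, d %| a' -> d %| b' -> d %| c' -> size d = 1%N].
Proof.
move=> a0; pose g := gcdp a (gcdp b c).
have g0 : g != 0 by rewrite gcdp_eq0 negb_and a0.
have ga : g %| a := dvdp_gcdl _ _.
have gb : g %| b := dvdp_trans (dvdp_gcdr _ _) (dvdp_gcdl _ _).
have gc : g %| c := dvdp_trans (dvdp_gcdr _ _) (dvdp_gcdr _ _).
pose k := lead_coef (a %/ g).
have k0 : k != 0 by rewrite lead_coef_eq0 dvdp_div_eq0.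
have E (x : {poly F}) : g %| x -> x = (k *: g) * (k^-1 *: (x %/ g)).
  by move=> gx; rewrite -scalerAl -scalerAr scalerA mulfV // scale1r mulrC divpK.
exists (k *: g), (k^-1 *: (a %/ g)), (k^-1 *: (b %/ g)), (k^-1 *: (c %/ g)).
split; try exact: E.
  by rewrite monicE lead_coefZ mulVf.
move=> d; rewrite !dvdpZr ?invr_eq0 // => da db dc.
have H (x : {poly F}) : g %| x -> d %| x %/ g -> d * g %| x.
  by move=> gx dx; rewrite -(divpK gx) dvdp_mul2r.
have dg : d * g %| g by rewrite !dvdp_gcd !H.
apply/eqP; rewrite -dvdp1 -(dvdp_mul2r _ _ g0) mul1r //.
Qed.

(* [P] has roots [al] and [al'], the first one irrational; [h], [e] and [e'] are the
   logarithms of the height of [P] and of the inverses of the distances to the roots. *)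
Definition quad_approx xi (P : {poly {poly F}}) (al al' : L) (h e e' : nat) :=
  [/\ size P = 3%N, lead_coef P \is monic, primitive_poly P,
      (forall x, pev P x = tev (lead_coef P) * (x - al) * (x - al')) &
      (forall f g : {poly F}, tev f + tev g * al = 0 -> g = 0)] /\
  [/\ size (lead_coef P) = h.+1, abs al <= 1, abs al' <= 1,
      abs (xi - al) * Q ^+ e = 1 & abs (xi - al') * Q ^+ e' = 1].

(* The quadratic form whose roots are fixed by [word_mx v] need not be primitive: for
   [v = [:: lam; mu]], and for the rotations of W_i when p = 2, it is divisible by [X]. *)
Definition bounded_content v := forall g : {poly F},
  g %| word_mx v 1 0 -> g %| word_mx v 0 1 -> g %| word_mx v 0 0 - word_mx v 1 1 ->
  (size g <= 2)%N.

(** The three polynomials are the coefficients of the form of [v] after a substitution by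
    [word_mx w]. The determinant is 1 up to sign, so the substitution can be undone, and a common
    divisor of the new coefficients divides the old ones. *)
Lemma quad_poly_content w v :
  let M := word_mx w in let N := word_mx v in
  let a := N 1 0 in let b := N 0 0 - N 1 1 in let c := - N 0 1 in
  forall g : {poly F}, bounded_content v ->
  g %| a * M 0 1 ^+ 2 + b * M 0 1 * M 0 0 + c * M 0 0 ^+ 2 ->
  g %| - (a * M 0 1 * M 1 1 *+ 2 + b * (M 0 1 * M 1 0 + M 1 1 * M 0 0) + c * M 0 0 * M 1 0 *+ 2) ->
  g %| a * M 1 1 ^+ 2 + b * M 1 1 * M 1 0 + c * M 1 0 ^+ 2 -> (size g <= 2)%N.
Proof.
move=> M N a b c g bc.
set P2 := (X in g %| X -> _); set P1 := (X in _ -> g %| X -> _).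
set P0 := (X in _ -> _ -> g %| X -> _) => g2 g1 g0.
have e2 : (M 0 0 * M 1 1 - M 0 1 * M 1 0) ^+ 2 = 1 by rewrite word_mx_det sqrr_sign.
have D (x y z : {poly F}) : g %| x * P2 + y * P1 + z * P0 by rewrite !dvdp_add ?dvdp_mull.
apply: bc.
- rewrite -/N -/a -[a]mulr1 -e2.
  have -> : a * (M 0 0 * M 1 1 - M 0 1 * M 1 0) ^+ 2
     = M 1 0 ^+ 2 * P2 + M 1 0 * M 0 0 * P1 + M 0 0 ^+ 2 * P0 by rewrite /P2 /P1 /P0; ring.
  exact: D.
- rewrite -dvdpNr -/N -/c -[c]mulr1 -e2.
  have -> : c * (M 0 0 * M 1 1 - M 0 1 * M 1 0) ^+ 2
     = M 1 1 ^+ 2 * P2 + M 1 1 * M 0 1 * P1 + M 0 1 ^+ 2 * P0 by rewrite /P2 /P1 /P0; ring.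
  exact: D.
- rewrite -/N -/b -[b]mulr1 -e2.
  have -> : b * (M 0 0 * M 1 1 - M 0 1 * M 1 0) ^+ 2
     = - (M 1 0 * M 1 1 *+ 2) * P2 + - (M 1 0 * M 0 1 + M 0 0 * M 1 1) * P1
       + - (M 0 0 * M 0 1 *+ 2) * P0 by rewrite /P2 /P1 /P0; ring.
  exact: D.
Qed.

Lemma tev_quad (a b c m n : {poly F}) :
  tev (a * m ^+ 2 + b * m * n + c * n ^+ 2)
  = tev a * tev m ^+ 2 + tev b * tev m * tev n + tev c * tev n ^+ 2.
Proof. by rewrite !rmorphD !rmorphM /= !expr2. Qed.

Lemma tev_quad_mid (a b c m n m' n' : {poly F}) :
  tev (- (a * m * m' *+ 2 + b * (m * n' + m' * n) + c * n * n' *+ 2))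
  = - (tev a * tev m * tev m' *+ 2 + tev b * (tev m * tev n' + tev m' * tev n)
       + tev c * tev n * tev n' *+ 2).
Proof. by rewrite rmorphN !rmorphD !rmorphM !rmorphD !rmorphM /= !mulr2n. Qed.

(** The root [al] is the inverse of [w], 1 followed by the period [rcons v c]; it shares with [xi]
    exactly the letters of [w], 1, [u], as [e' != e] comes next. Its conjugate shares exactly [w],
    because [c != 1]. The height is the degree of the leading coefficient once the content is
    removed. *)
Lemma quad_approx_word w v u c e e' rest i xi y :
  0 \notin w -> 0 \notin rcons v c -> v != [::] -> c != 1 -> e != 0 -> e' != e ->
  flatten (nseq i (rcons v c)) = u ++ e' :: rest -> bounded_content (rcons v c) ->
  abs y = Q -> xi = (mob (rcons w 1 ++ rcons u e) y)^-1 ->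
  exists P al al' h, ((size v + 1 + 2 * size w)%N <= h <= (size v + 2 + 2 * size w)%N)%N /\
    quad_approx xi P al al' h (2 * (size w + size u) + 3) (2 * size w + 1).
Proof.
move=> w0 vc0 vN c1 e0 ee' Ev bc yQ xiE.
have [|b [b' [bQ b'Q H1 H2 Hb]]] := fixed_points vc0.
  by rewrite size_rcons; case: (v) vN.
have Hc := conj_last_letter vc0 vN b'Q H1 H2.
have b'0 : b' != 0 by rewrite -(abs_eq0 Habs) b'Q invr_eq0.
have : 0 \notin u ++ e' :: rest by rewrite -Ev notin_power.
rewrite mem_cat inE !negb_or eq_sym => /and3P[u0 e'0 rest0].
have Hb2 : mob (u ++ e' :: rest) b = b by rewrite -Ev mob_power.
pose w1 := rcons w 1.
have w10 : 0 \notin w1 by rewrite mem_rcons inE negb_or w0 eq_sym oner_neq0.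
pose al := (mob w1 b)^-1.
(* Since [b'] has absolute value [Q^-1], [abs_mob] and [mob_mx] do not apply to it. The final letter
   of [rcons w 1] is absorbed into the complete quotient [z], of absolute value [Q] because [-1/b']
   starts with [c] and [c != 1]. *)
pose z := lt 1 + b'^-1.
have zQ : abs z = Q.
  have -> : z = lt (1 - c) + (b'^-1 + lt c) by rewrite /z /= rmorphB rmorph1; ring.
  by rewrite abs_letter // subr_eq0 eq_sym.
pose al' := (mob w z)^-1.
have mbQ := abs_mob w10 bQ; have mzQ := abs_mob w0 zQ.
have QV1 : Q^-1 <= 1 by rewrite invf_le1 ?ltW.
pose M := word_mx w1.
pose N := word_mx (rcons v c).
pose A2 := N 1 0; pose A1 := N 0 0 - N 1 1; pose A0 := - N 0 1.
(* The equation of [b] and [b'] is [A2 y^2 - A1 y + A0 = 0]. Substituting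
   [y = (M11 - M01 x) / (M00 x - M10)], the inverse of [x = (M10 y + M11) / (M00 y + M01)], and
   clearing denominators gives these coefficients. *)
pose P2 := A2 * M 0 1 ^+ 2 + A1 * M 0 1 * M 0 0 + A0 * M 0 0 ^+ 2.
pose P1 := - (A2 * M 0 1 * M 1 1 *+ 2 + A1 * (M 0 1 * M 1 0 + M 1 1 * M 0 0) + A0 * M 0 0 * M 1 0 *+ 2).
pose P0 := A2 * M 1 1 ^+ 2 + A1 * M 1 1 * M 1 0 + A0 * M 1 0 ^+ 2.
have tA1 : tev A1 = tev A2 * (b + b') by rewrite rmorphB -opprB H1 mulNr opprK.
have tA0 : tev A0 = tev A2 * b * b' by rewrite rmorphN H2.
have [D1 D2] := mob_mx w10 bQ; have [D1' D2'] := mob_mx w0 zQ.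
pose m i j := tev (M i j).
rewrite -/M -/(m 1 0) -/(m 1 1) -/(m 0 0) -/(m 0 1) in D1 D2.
have alE : m 1 0 * b + m 1 1 = al * (m 0 0 * b + m 0 1).
  by rewrite -D2 mulKf // abs_neq0.
have al'D : m 0 0 * b' + m 0 1 = b' * (mx w 0 0 * z + mx w 0 1).
  by rewrite /m /M !word_mx_rcons rmorphD rmorphM /= tevZ tevX /z rmorph1; field.
have al'E : m 1 0 * b' + m 1 1 = al' * (m 0 0 * b' + m 0 1).
  rewrite al'D -D2' mulrCA mulKf ?abs_neq0 //.
  by rewrite /m /M !word_mx_rcons rmorphD rmorphM /= tevZ tevX /z rmorph1; field.
have tP2 : tev P2 = tev A2 * (m 0 0 * b + m 0 1) * (m 0 0 * b' + m 0 1).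
  by rewrite tev_quad tA1 tA0 -!/(m _ _); ring.
have tP x : tev P2 * x ^+ 2 + tev P1 * x + tev P0 = tev P2 * (x - al) * (x - al').
  transitivity (tev A2 * ((m 0 0 * b + m 0 1) * x - (m 1 0 * b + m 1 1))
                * ((m 0 0 * b' + m 0 1) * x - (m 1 0 * b' + m 1 1))).
    by rewrite !tev_quad tev_quad_mid tA1 tA0 -!/(m _ _); ring.
  by rewrite alE al'E tP2; ring.
have aP2 : abs (tev P2) = Q ^+ (size v + 2 + 2 * size w).
  rewrite tP2 al'D -D2 -D2' !(absM Habs) mbQ mzQ b'Q D1 D1'.
  have [_ s10] := size_word_mx_col0 vc0; rewrite size_rcons in s10.
  rewrite (abs_tev_size s10) size_rcons.
  have -> : (size v + 2 + 2 * size w = size v + (size w).+1 + size w + 1)%N by clear; lia.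
  by rewrite !exprD expr1; field.
have P20 : P2 != 0 by rewrite -(tev_eq0 Habs) // -(abs_eq0 Habs) aP2 expf_neq0.
(* The content [g] is divided out to make the polynomial primitive. Its degree is 0 or 1, which is
   why [h] is known only up to one unit. *)
have [g [p2 [p1 [p0 [E2 E1 E0 p2m pc]]]]] := content_split P1 P0 P20.
have sg : (size g <= 2)%N.
  by apply: (@quad_poly_content w1 (rcons v c)) => //;
    rewrite -/M -/N -/A2 -/A1 -/A0 -/P2 -/P1 -/P0 ?E2 ?E1 ?E0 dvdp_mulr.
have g0 : g != 0 by apply: contraNneq P20 => g0; rewrite E2 g0 mul0r.
have p20 := monic_neq0 p2m.
pose P := Poly [:: p0; p1; p2].
have PE : P = [:: p0; p1; p2] :> seq _ by rewrite (PolyK (c := 0)).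
have lP : lead_coef P = p2 by rewrite lead_coefE PE.
exists P, al, al', (size p2).-1.
have sP2 : size P2 = (size v + 2 + 2 * size w).+1.
  by apply/eqP; rewrite -(size_tevP Habs) // aP2.
split.
  have : (size g + size p2).-1 = (size v + 2 + 2 * size w).+1.
    by rewrite -sP2 E2 size_mul.
  move: sg.
  have : (0 < size g)%N by rewrite size_poly_gt0.
  have : (0 < size p2)%N by rewrite size_poly_gt0.
  by clear; lia.
split; split.
- by rewrite PE.
- by rewrite lP.
- move=> d Hd; apply: pc; first by have := Hd 2; rewrite PE.
    by have := Hd 1%N; rewrite PE.
  by have := Hd 0%N; rewrite PE.
- move=> x; rewrite lP.
  have g0' : tev g != 0 by rewrite (tev_eq0 Habs).
  apply: (mulfI g0'); rewrite !mulrA -rmorphM /= -E2 -tP E2 E1 E0 !rmorphM /=.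
  rewrite /P /= !cons_poly_def !pevMXaddC pev0; ring.
- move=> f g' H.
  have mb0 := abs_neq0 mbQ.
  have H' : tev g' + tev f * mob w1 b = 0.
    by apply: (mulIf (invr_neq0 mb0)); rewrite mul0r -H /al; field.
  have f0 : f = 0.
    apply: mob_irrational H' => n.
    exists (w1 ++ flatten (nseq n (rcons v c))), b; split=> //.
    + by rewrite size_cat size_power size_rcons; clear; lia.
    + by rewrite mem_cat negb_or w10 notin_power.
    + by rewrite mob_cat mob_power.
  by apply/eqP; rewrite -(tev_eq0 Habs) //; move: H'; rewrite f0 rmorph0 mul0r addr0 => ->.
- by rewrite lP prednK // size_poly_gt0.
- by rewrite absVQ.
- by rewrite absVQ.
- have [Y Z] : abs (lt e + y^-1) = Q /\ abs (mob (e' :: rest) b) = Q.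
    rewrite abs_letter // ?absVQ ?QV_lt //; split=> //.
    by apply: abs_mob bQ; rewrite inE negb_or eq_sym e'0.
  have ED : abs (mob (w1 ++ u) (lt e + y^-1) - mob (w1 ++ u) (mob (e' :: rest) b))
       * Q ^+ (2 * size (w1 ++ u)) = Q.
    rewrite mob_diff //; last by rewrite mem_cat negb_or w10.
    have -> : lt e + y^-1 - mob (e' :: rest) b = lt (e - e') + (y^-1 - (mob rest b)^-1).
      by rewrite /= rmorphB; ring.
    rewrite abs_letter // ?subr_eq0 1?eq_sym //; apply: le_lt_trans QV_lt.
    by rewrite (absB_le Habs) ?absVQ // abs_mob.
  have XE : xi = (mob (w1 ++ u) (lt e + y^-1))^-1 by rewrite xiE -(cats1 u) catA mob_cat.
  have AE : al = (mob (w1 ++ u) (mob (e' :: rest) b))^-1.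
    by rewrite [mob (w1 ++ u) _]mob_cat -[mob u (mob _ _)]mob_cat Hb2.
  have wu0 : 0 \notin w1 ++ u by rewrite mem_cat negb_or w10.
  rewrite XE AE; apply: (mulIf Qn0); rewrite mul1r -[RHS]ED.
  rewrite -(abs_subV (abs_mob wu0 Y) (abs_mob wu0 Z)) -!mulrA -exprSr -!exprS.
  by congr (_ * _ ^+ _); rewrite size_cat size_rcons; clear; lia.
- have uQ : abs (mob (rcons u e) y) = Q.
    by apply: abs_mob yQ; rewrite mem_rcons inE negb_or eq_sym e0.
  have YQ : abs (lt 1 + (mob (rcons u e) y)^-1) = Q.
    by rewrite abs_letter ?oner_neq0 // absVQ ?QV_lt.
  have XE : xi = (mob w (lt 1 + (mob (rcons u e) y)^-1))^-1.
    by rewrite xiE -(cats1 w) -catA mob_cat.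
  have ED : abs (mob w (lt 1 + (mob (rcons u e) y)^-1) - mob w z) * Q ^+ (2 * size w) = Q.
    rewrite mob_diff // (_ : _ - z = (mob (rcons u e) y)^-1 - b'^-1); last by rewrite /z; ring.
    by rewrite (absD_eq Habs) (absN Habs) (absV Habs b') b'Q invrK // absVQ ?QV_lt.
  rewrite XE; apply: (mulIf Qn0); rewrite mul1r -[RHS]ED.
  rewrite -(abs_subV (abs_mob w0 YQ) mzQ) -!mulrA -exprSr -!exprS.
  by congr (_ * _ ^+ _); clear; lia.
Qed.

End Approximation.

(** * Quadratic polynomials over F[T] *)

Section Gauss.
Variable F : finFieldType.
Implicit Types (c d : {poly F}) (P S T : {poly {poly F}}).

Lemma exists_irreducible_factor c : c != 0 -> size c != 1%N ->
  exists2 d, irreducible_poly d & d %| c.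
Proof.
elim: {c}_.+1 {-2}c (ltnSn (size c)) => // n IH c cn c0 c1.
have sc : (1 < size c)%N.
  by rewrite ltn_neqAle eq_sym c1 size_poly_gt0.
have [irr|] := pselect (irreducible_poly c); first by exists c.
move=> nirr; have [d [d1 dc nd]] : exists d, [/\ size d != 1%N, d %| c & ~~ (d %= c)].
  apply: contrapT => nd; apply: nirr; split=> // d d1 dc.
  by apply: contrapT => /negP ndc; apply: nd; exists d.
have d0 : d != 0 by apply: contraNneq c0 => d0; rewrite d0 dvd0p in dc.
have [|||e irr ed] // := IH d.
  rewrite (leq_trans _ (ltnSE cn)) // ltn_neqAle dvdp_leq // andbT.
  by rewrite dvdp_size_eqp.
by exists e => //; apply: dvdp_trans dc.
Qed.

Lemma irreducible_dvd_mul d a b : irreducible_poly d -> d %| a * b -> ~~ (d %| a) -> d %| b.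
Proof. by move=> irr dab nda; rewrite -(Gauss_dvdpr _ (q := a)) // irreducible_poly_coprime. Qed.

(** Gauss's lemma: if [i] and [j] are the least indices of coefficients of [P] and [S] not divisible
    by [d], then coefficient [i + j] of the product is not divisible by [d] either. *)
Lemma irreducible_dvd_coefM d P S : irreducible_poly d ->
  (forall i, d %| (P * S)`_i) -> (exists i, ~~ (d %| P`_i)) -> forall i, d %| S`_i.
Proof.
move=> irr dPS exP; case: (ex_minnP exP) => i ndPi mini.
apply: contrapT => /existsNP /= exS.
have exS' : exists j, ~~ (d %| S`_j) by have [j /negP] := exS; exists j.
case: (ex_minnP exS') => j ndSj minj; case/negP: ndSj.
apply: irreducible_dvd_mul ndPi => //.
have lt : (i < (i + j).+1)%N by rewrite ltnS leq_addr.
have := dPS (i + j)%N; rewrite coefM (bigD1 (Ordinal lt)) //= addKn dvdp_addl //.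
apply: (big_ind (fun x => d %| x)); rewrite ?dvdp0 //.
  by move=> x y; apply: dvdp_add.
move=> k; rewrite -val_eqE /= => ki.
case: (ltnP k i) => [ltk|lek].
  by rewrite dvdp_mulr //; apply: contraTT ltk => /mini; rewrite -leqNgt.
rewrite dvdp_mull //; have ltk : (i + j - k < j)%N by have := ltn_ord k; lia.
by apply: contraTT ltk => /minj; rewrite -leqNgt.
Qed.

(** The irreducible factors of [c] are removed one by one: each divides all coefficients of [S],
    since [P] is primitive. *)
Lemma primitive_Gauss c P S T : primitive_poly P -> c != 0 -> c *: T = P * S ->
  exists S', T = P * S'.
Proof.
move=> prim; elim: {c}_.+1 {-2}c (ltnSn (size c)) S => // n IH c cn S c0 E.
have [/eqP|c1] := eqVneq (size c) 1%N.
  move=> /size_poly1P[k k0 ck]; exists ((k^-1)%:P *: S).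
  by rewrite -scalerAr -E scalerA ck -polyCM mulVf // scale1r.
have [d irr dc] := exists_irreducible_factor c0 c1.
have d1 := irr.1.
have dS : forall i, d %| S`_i.
  apply: (irreducible_dvd_coefM (P := P) irr) => [i|].
    by rewrite -E coefZ dvdp_mulr.
  apply: contrapT => nex; have : size d = 1%N.
    by apply: prim => i; apply: contrapT => /negP ni; apply: nex; exists i.
  by move=> sd; rewrite sd in d1.
have d0 : d != 0 by rewrite -size_poly_gt0 ltnW.
have [S1 S1E] : exists S1, S = d *: S1.
  exists (\poly_(i < size S) (S`_i %/ d)); apply/polyP => i.
  rewrite coefZ coef_poly; case: ltnP => [_|/leq_sizeP->//]; last by rewrite mulr0.
  by rewrite mulrC divpK.
have cE : c = d * (c %/ d) by rewrite mulrC divpK.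
have cd0 : c %/ d != 0 by apply: contraNneq c0 => z; rewrite cE z mulr0.
apply: (IH (c %/ d) _ S1) => //.
  rewrite (leq_trans _ (ltnSE cn)) // [in ltnRHS]cE size_mul //.
  by case: (size d) d1 => [|[|n']] // _; rewrite !addSn /= ltnS leq_addl.
have dP0 : d%:P != 0 by rewrite polyC_eq0.
apply: (mulfI dP0); rewrite -!mul_polyC mulrA -polyCM -cE mul_polyC E S1E -mul_polyC.
by rewrite mulrCA.
Qed.

End Gauss.

(** * Norms, divisibility and heights *)

Section Quadratic.
Variables (R : realType) (F : finFieldType) (L : closedFieldType).
Variables (q : nat) (iF : {rmorphism F -> L}) (Tl : L) (abs : L -> R).
Hypotheses (Habs : is_ext_abs q iF Tl abs) (q_gt1 : (1 < q)%N).

Local Notation Q := (q%:R : R).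
Local Notation tev := (tev iF Tl).
Local Notation pev := (pev iF Tl).
Local Notation quad_approx := (quad_approx q iF Tl abs).
Let Q1 : 1 < Q := Q_gt1 R q_gt1.
Let Q0 : 0 < Q := Q_gt0 R q_gt1.

Lemma poly3E (P : {poly {poly F}}) : (size P <= 3)%N ->
  P = ((P`_2)%:P * 'X + (P`_1)%:P) * 'X + (P`_0)%:P.
Proof.
move=> sP; apply/polyP => -[|[|[|i]]];
  rewrite !(coefD, coefMX, coefC) /= ?(add0r, addr0) //.
by rewrite nth_default // (leq_trans sP).
Qed.

Lemma pev3 (P : {poly {poly F}}) x : (size P <= 3)%N ->
  pev P x = tev P`_2 * x ^+ 2 + tev P`_1 * x + tev P`_0.
Proof. by move=> /poly3E {1}->; rewrite !pevMXaddC pevC expr2 mulrDl mulrA. Qed.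

Lemma tev_dot3 (x y z x' y' z' : {poly F}) :
  tev (x * x' + y * y' + z * z') = tev x * tev x' + tev y * tev y' + tev z * tev z'.
Proof. by rewrite !rmorphD !rmorphM. Qed.

Lemma coef_quadM (P S : {poly {poly F}}) i : size P = 3%N ->
  (P * S)`_i.+2 = P`_2 * S`_i + P`_1 * S`_i.+1 + P`_0 * S`_i.+2.
Proof.
move=> sP; rewrite [in LHS](poly3E (_ : size P <= 3)%N) ?sP //.
set a := P`_2; set b := P`_1; set c := P`_0.
have -> : ((a%:P * 'X + b%:P) * 'X + c%:P) * S = (a%:P * S * 'X + b%:P * S) * 'X + c%:P * S.
  by rewrite mulrDl (mulrAC _ 'X) mulrDl (mulrAC _ 'X).
by rewrite !(coefD, coefMX, coefCM).
Qed.

Definition in_tev x := exists z : {poly F}, x = tev z.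

Lemma in_tevD x y : in_tev x -> in_tev y -> in_tev (x + y).
Proof. by move=> [a ->] [b ->]; exists (a + b); rewrite rmorphD. Qed.
Lemma in_tevM x y : in_tev x -> in_tev y -> in_tev (x * y).
Proof. by move=> [a ->] [b ->]; exists (a * b); rewrite rmorphM. Qed.
Lemma in_tevX x n : in_tev x -> in_tev (x ^+ n).
Proof. by move=> [a ->]; exists (a ^+ n); rewrite rmorphXn. Qed.
Lemma in_tev_tev a : in_tev (tev a). Proof. by exists a. Qed.

Section Norm.
Variables (a : L) (al al' : L).
Hypotheses (Ra : in_tev a) (Rs : in_tev (a * (al + al'))) (Rp : in_tev (a * al * al')).

(** Newton's recurrence for power sums, where the powers of [a] clear the denominators. *)
Lemma power_sum_tev n : in_tev (a ^+ n * (al ^+ n + al' ^+ n)).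
Proof.
suff [] : in_tev (a ^+ n * (al ^+ n + al' ^+ n))
   /\ in_tev (a ^+ n.+1 * (al ^+ n.+1 + al' ^+ n.+1)) by [].
elim: n => [|n [IH1 IH2]].
  rewrite !expr0 mul1r !expr1; split=> //.
  by exists (1 + 1); rewrite rmorphD rmorph1.
split=> //; have -> : a ^+ n.+2 * (al ^+ n.+2 + al' ^+ n.+2) =
   (a * (al + al')) * (a ^+ n.+1 * (al ^+ n.+1 + al' ^+ n.+1))
   + (tev (- 1) * (a * (a * al * al'))) * (a ^+ n * (al ^+ n + al' ^+ n)).
  by rewrite rmorphN1 !exprS; ring.
apply: in_tevD; apply: in_tevM => //.
by apply: in_tevM; [exact: in_tev_tev | apply: in_tevM].
Qed.

(** These traces occur in the induction for the norm. The exponent [k] absorbs the factor [al] that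
    each Horner step brings. *)
Lemma trace_tev (P : {poly {poly F}}) m k : (size P <= m.+1)%N ->
  in_tev (a ^+ (m + k) * (al ^+ k * pev P al + al' ^+ k * pev P al')).
Proof.
elim/poly_ind: P m k => [|P c IH] m k sP.
  by rewrite !pev0 !mulr0 addr0 mulr0; exists 0; rewrite rmorph0.
rewrite !pevMXaddC.
have Hc : in_tev (a ^+ (m + k) * (al ^+ k * tev c + al' ^+ k * tev c)).
  have -> : a ^+ (m + k) * (al ^+ k * tev c + al' ^+ k * tev c)
     = a ^+ m * (a ^+ k * (al ^+ k + al' ^+ k)) * tev c by rewrite exprD; ring.
  apply: in_tevM; last exact: in_tev_tev.
  by apply: in_tevM; [exact: in_tevX | exact: power_sum_tev].
have [->|P0] := eqVneq P 0; first by rewrite !pev0 !mul0r !add0r.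
move: sP; rewrite size_MXaddC (negbTE P0) /= ltnS.
case: m Hc => [|m] Hc sP; first by rewrite leqn0 size_poly_eq0 (negbTE P0) in sP.
have := IH m k.+1 sP; rewrite addnS -addSn => H.
have -> : a ^+ (m.+1 + k) * (al ^+ k * (pev P al * al + tev c) + al' ^+ k * (pev P al' * al' + tev c))
  = a ^+ (m.+1 + k) * (al ^+ k.+1 * pev P al + al' ^+ k.+1 * pev P al')
    + a ^+ (m.+1 + k) * (al ^+ k * tev c + al' ^+ k * tev c) by rewrite !exprS; ring.
exact: in_tevD.
Qed.

(* Up to sign this is the resultant of [P] with the quadratic polynomial of
   leading coefficient [a] and roots [al], [al']. *)
Lemma norm_tev (P : {poly {poly F}}) m : (size P <= m.+1)%N ->
  in_tev (a ^+ m * (pev P al * pev P al')).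
Proof.
elim/poly_ind: P m => [|P c IH] m sP.
  by rewrite !pev0 !mulr0; exists 0; rewrite rmorph0.
rewrite !pevMXaddC.
have Hc : in_tev (a ^+ m * (tev c * tev c)).
  by apply: in_tevM; [exact: in_tevX | apply: in_tevM; exact: in_tev_tev].
have [->|P0] := eqVneq P 0; first by rewrite !pev0 !mul0r !add0r.
move: sP; rewrite size_MXaddC (negbTE P0) /= ltnS.
case: m Hc => [|m] Hc sP; first by rewrite leqn0 size_poly_eq0 (negbTE P0) in sP.
(* The product of two Horner steps is a norm of lower degree, plus a trace, plus a constant. *)
have -> : a ^+ m.+1 * ((pev P al * al + tev c) * (pev P al' * al' + tev c))
   = (a * al * al') * (a ^+ m * (pev P al * pev P al'))
     + (tev c * (a ^+ (m + 1) * (al ^+ 1 * pev P al + al' ^+ 1 * pev P al'))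
        + a ^+ m.+1 * (tev c * tev c)) by rewrite addn1 !exprS !expr0; ring.
apply: in_tevD; first by apply: in_tevM (IH _ sP).
by apply: in_tevD Hc; apply: in_tevM; [exact: in_tev_tev | exact: trace_tev].
Qed.

End Norm.

Section OneQuadratic.
Variables (xi : L) (P : {poly {poly F}}) (al al' : L) (h e e' : nat).
Hypothesis HP : quad_approx xi P al al' h e e'.

Let a := lead_coef P.

Lemma quad_size : size P = 3%N. Proof. by case: HP => -[]. Qed.
Lemma quad_neq0 : P != 0. Proof. by rewrite -size_poly_eq0 quad_size. Qed.
Lemma quad_lead : a = P`_2. Proof. by rewrite /a lead_coefE quad_size. Qed.
Lemma quad_lead_neq0 : a != 0. Proof. by rewrite lead_coef_eq0 quad_neq0. Qed.
Lemma quad_pev x : pev P x = tev a * (x - al) * (x - al').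
Proof. by case: HP => -[_ _ _ H _] _; apply: H. Qed.
Lemma quad_abs_lead : abs (tev a) = Q ^+ h.
Proof. by case: HP => _ [sa _ _ _ _]; apply: (abs_tev_size Habs q_gt1 sa). Qed.

Lemma quad_coef0 : tev P`_0 = tev a * al * al'.
Proof.
have := quad_pev 0; rewrite pev3 ?quad_size // expr0n /= !mulr0 !add0r => ->.
by rewrite !(mulrN, mulNr) opprK.
Qed.

Lemma quad_coef1 : tev P`_1 = - (tev a * (al + al')).
Proof.
have := quad_pev 1; rewrite pev3 ?quad_size // -quad_lead quad_coef0 expr1n !mulr1.
set t := tev a; set b := tev _ => E.
by apply: (addrI t); apply: (addIr (t * al * al')); rewrite E; ring.
Qed.

Lemma quad_irrational (f g : {poly F}) : tev f + tev g * al = 0 -> g = 0.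
Proof. by case: HP => -[_ _ _ _ H] _; apply: H. Qed.

Lemma quad_irrational' (f g : {poly F}) : tev f + tev g * al' = 0 -> g = 0.
Proof.
move=> E; have ta : tev a != 0 by rewrite (tev_eq0 Habs) // quad_lead_neq0.
have : tev (a * f - P`_1 * g) + tev (- (a * g)) * al = 0.
  rewrite rmorphB rmorphN !rmorphM /= quad_coef1.
  transitivity (tev a * (tev f + tev g * al')); first by ring.
  by rewrite E mulr0.
move/quad_irrational/eqP; rewrite oppr_eq0 mulf_eq0 (negbTE quad_lead_neq0).
by move/eqP.
Qed.

Lemma quad_root_le : abs al <= 1 /\ abs al' <= 1.
Proof. by case: HP => _ []. Qed.

Lemma quad_root x : pev P x = 0 -> x = al \/ x = al'.
Proof.
move/eqP; rewrite quad_pev !mulf_eq0 (tev_eq0 Habs) // (negbTE quad_lead_neq0) /= !subr_eq0.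
by move=> /orP[/eqP|/eqP]; [left|right].
Qed.

Lemma quad_coef_le i : abs (tev P`_i) <= Q ^+ h.
Proof.
have [al1 al1'] := quad_root_le; have Qh : 0 <= Q ^+ h by rewrite exprn_ge0 // ltW.
case: i => [|[|[|i]]].
- rewrite quad_coef0 -mulrA (absM Habs) quad_abs_lead ler_piMr //.
  by rewrite (absM Habs) mulr_ile1 ?(abs_ge0 Habs).
- rewrite quad_coef1 (absN Habs) (absM Habs) quad_abs_lead ler_piMr //.
  exact: (absD_le Habs).
- by rewrite -quad_lead quad_abs_lead.
- by rewrite nth_default ?quad_size // rmorph0 (abs0 Habs) exprn_ge0 // ltW.
Qed.

Lemma quad_lheight : lheight P = h.
Proof.
apply/eqP; rewrite eqn_leq (lheight_le Habs) //=; last exact: quad_coef_le.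
by rewrite -(ler_eXn2l Q1) -quad_abs_lead quad_lead (abs_coef_le Habs).
Qed.

(** Pseudo-division leaves a remainder of degree at most 1 vanishing at [x]. It is 0 because both
    roots are irrational, and Gauss's lemma then removes the power of the leading coefficient. *)
Lemma quad_dvd (S : {poly {poly F}}) x : x = al \/ x = al' -> pev S x = 0 ->
  exists S', S = P * S'.
Proof.
move=> xE Sx.
have := Pdiv.Idomain.divp_eq S P; rewrite -/a.
set c := a ^+ _; set D := (_ %/ _)%R; set r := (_ %% _)%R => E.
have sr : (size r <= 2)%N.
  have : (size r < size P)%N by rewrite Pdiv.Idomain.ltn_modp quad_neq0.
  by rewrite quad_size.
have Px : pev P x = 0.
  by rewrite quad_pev; case: xE => ->; rewrite subrr ?mulr0 ?mul0r.
have rx : pev r x = 0.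
  have := congr1 (fun S => pev S x) E; rewrite pevD pevM Px mulr0 add0r => <-.
  by rewrite -mul_polyC pevM Sx mulr0.
have rE : tev r`_0 + tev r`_1 * x = 0.
  rewrite -rx pev3 1?(leq_trans sr) // (nth_default 0 (_ : size r <= 2)%N) //.
  by rewrite rmorph0 mul0r add0r addrC.
have r1 : r`_1 = 0.
  by case: xE => xE; rewrite xE in rE; [apply: quad_irrational rE | apply: quad_irrational' rE].
have r0 : r`_0 = 0.
  by apply/eqP; rewrite -(tev_eq0 Habs) // -rE r1 rmorph0 mul0r addr0.
have rz : r = 0.
  apply/polyP => -[|[|i]]; rewrite coef0 //.
  by rewrite nth_default // (leq_trans sr).
apply: (@primitive_Gauss _ c P D) => //; first by case: HP => -[].
  by rewrite expf_neq0 // quad_lead_neq0.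
by rewrite E rz addr0 mulrC.
Qed.

(** Half of the multiplicativity of the height. No coefficient of [P] exceeds its leading one in
    absolute value, so descending induction on [i] recovers [a * S_i] from coefficient [i + 2] of
    the product and the higher coefficients of [S]. *)
Lemma quad_lheightM (S : {poly {poly F}}) : S != 0 ->
  (h + lheight S <= lheight (P * S)%R)%N.
Proof.
move=> S0; set n := lheight (P * S)%R.
have key k i : (size S <= i + k)%N -> Q ^+ h * abs (tev S`_i) <= Q ^+ n.
  elim: k i => [|k IH] i ik.
    by rewrite addn0 in ik; rewrite nth_default // rmorph0 (abs0 Habs) mulr0 exprn_ge0 // ltW.
  have : (size S <= i.+1 + k)%N by rewrite addSnnS.
  have : (size S <= i.+2 + k)%N by apply: leq_trans ik _; rewrite addSnnS leq_add2r.
  move=> /IH H2 /IH H1.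
  have E : tev a * tev S`_i = tev (P * S)`_i.+2 - tev P`_0 * tev S`_i.+2 - tev P`_1 * tev S`_i.+1.
    rewrite (coef_quadM _ _ quad_size) tev_dot3 -quad_lead.
    by rewrite !addrK.
  rewrite -quad_abs_lead -(absM Habs) E.
  have B j k' : abs (tev P`_j * tev S`_k') <= Q ^+ h * abs (tev S`_k').
    by rewrite (absM Habs) ler_wpM2r ?(abs_ge0 Habs) // quad_coef_le.
  apply: (absB_le Habs); [apply: (absB_le Habs)|].
  - exact: abs_coef_le.
  - exact: le_trans (B _ _) H2.
  - exact: le_trans (B _ _) H1.
have hS i : Q ^+ h * abs (tev S`_i) <= Q ^+ n.
  by apply: (key (size S)); rewrite leq_addl.
have hn : (h <= n)%N.
  rewrite -(ler_eXn2l Q1); apply: le_trans (hS (size S).-1).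
  rewrite ler_peMr ?exprn_ge0 ?(ltW Q0) // (abs_tev_ge1 Habs) //.
  by rewrite -lead_coefE lead_coef_eq0.
rewrite -(subnKC hn) leq_add2l.
apply: (lheight_le Habs) => // i.
by rewrite -(ler_pM2l (exprn_gt0 h Q0)) -exprD subnKC.
Qed.

(** A factor of degree 1 would give [P] a root in the field of fractions of F[T]. *)
Lemma quad_irreducible : irreducible_poly P.
Proof.
split=> [|S S1 SP]; first by rewrite quad_size.
have S0 : S != 0 by apply: contraNneq quad_neq0 => S0; rewrite S0 dvd0p in SP.
have := dvdp_leq quad_neq0 SP; rewrite quad_size => sS.
have [s3|s3] := eqVneq (size S) 3%N; first by rewrite -dvdp_size_eqp // s3 quad_size.
have s2 : size S = 2%N.
  by move: sS S1 s3; rewrite -size_poly_gt0 in S0; case: (size S) S0 => [|[|[|[|n]]]].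
have [[c D] /= c0 E] := Pdiv.Idomain.dvdpP _ _ SP.
have s10 : tev S`_1 != 0.
  by rewrite (tev_eq0 Habs) // (_ : S`_1 = lead_coef S) ?lead_coef_eq0 // lead_coefE s2.
pose x := - tev S`_0 / tev S`_1.
have Sx : tev S`_0 + tev S`_1 * x = 0 by rewrite /x; field.
have Px : pev P x = 0.
  have c0' : tev c != 0 by rewrite (tev_eq0 Habs).
  apply: (mulfI c0'); rewrite mulr0 -(pevC iF Tl c x) -pevM mul_polyC E pevM.
  rewrite (pev3 (P := S)) ?s2 // (nth_default 0 (_ : size S <= 2)%N) ?s2 //.
  by rewrite rmorph0 mul0r add0r addrC Sx mulr0.
move/eqP: s10; case; rewrite (_ : S`_1 = 0) ?rmorph0 //.
by case: (quad_root Px) => xE; rewrite xE in Sx; [exact: quad_irrational Sx|exact: quad_irrational' Sx].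
Qed.

Lemma quad_minpoly : is_minpoly iF Tl al P.
Proof.
case: (HP) => -[s3 lm pr _ _] _; split=> //; first by rewrite s3.
  exact: quad_irreducible.
by rewrite quad_pev subrr mulr0 mul0r.
Qed.

End OneQuadratic.

End Quadratic.

(** * Exponents from a sequence of quadratic approximations *)

Section Finiteness.
Local Open Scope classical_set_scope.

Lemma finite_bounded_polys (F : finFieldType) (n m : nat) :
  finite_set [set P : {poly {poly F}} |
    (size P <= n)%N /\ forall i, (size (P`_i)%R <= m)%N].
Proof.
pose f (u : {ffun 'I_n -> {ffun 'I_m -> F}}) : {poly {poly F}} :=
  \poly_(i < n) (if insub i is Some i' then
    \poly_(j < m) (if insub j is Some j' then u i' j' else 0) else 0).
apply: (@sub_finite_set _ _ (f @` setT)); last exact: finite_image finite_finset.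
move=> P /= [sP sPi]; exists [ffun i : 'I_n => [ffun j : 'I_m => P`_i`_j]] => //.
apply/polyP => i; rewrite coef_poly; case: ltnP => [lin|/(leq_trans sP)/leq_sizeP->//].
rewrite insubT; apply/polyP => j; rewrite coef_poly.
case: ltnP => [ljm|/(leq_trans (sPi i))/leq_sizeP->//].
by rewrite insubT !ffunE.
Qed.

Lemma unbounded_infinite_set (T : choiceType) (f : T -> nat) (A : set T) :
  (forall n, exists2 x, A x & (n <= f x)%N) -> infinite_set A.
Proof.
move=> H /finite_seqP[s AE].
have [x Ax] := H (\max_(y <- s) f y).+1.
have xs : x \in s by move: Ax; rewrite AE.
by rewrite ltnNge (bigop.leq_bigmax_seq x).
Qed.

Lemma finite_roots (L : closedFieldType) (p : {poly L}) : p != 0 ->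
  finite_set [set x | root p x].
Proof.
move=> p0; have [s pE] := closed_field_poly_normal p.
apply/finite_seqP; exists s; apply/seteqP; split=> x /=;
  by rewrite {1}pE rootZ ?lead_coef_eq0 // root_prod_XsubC.
Qed.

End Finiteness.

Section Exponents.
Variables (R : realType) (F : finFieldType) (L : closedFieldType).
Variables (q : nat) (iF : {rmorphism F -> L}) (Tl : L) (abs : L -> R).
Hypotheses (Habs : is_ext_abs q iF Tl abs) (q_gt1 : (1 < q)%N).

Local Notation Q := (q%:R : R).
Local Notation tev := (tev iF Tl).
Local Notation pev := (pev iF Tl).
Let Q1 : 1 < Q := Q_gt1 R q_gt1.
Let Q0 : 0 < Q := Q_gt0 R q_gt1.

Definition logQ (x : R) := ln x / ln Q.

Let lnQ : 0 < ln Q. Proof. exact: ln_gt0. Qed.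

Lemma logQM x y : 0 < x -> 0 < y -> logQ (x * y) = logQ x + logQ y.
Proof. by move=> x0 y0; rewrite /logQ lnM ?posrE // mulrDl. Qed.

Lemma logQX n : logQ (Q ^+ n) = n%:R.
Proof. by rewrite /logQ lnXn // -[ln Q *+ n]mulr_natl mulfK // gt_eqF. Qed.

Lemma logQV x : 0 < x -> logQ x^-1 = - logQ x.
Proof. by move=> x0; rewrite /logQ lnV ?posrE // mulNr. Qed.

Lemma logQ_powR x t : logQ (powR x t) = t * logQ x.
Proof. by rewrite /logQ ln_powR mulrA. Qed.

Lemma ler_logQ x y : 0 < x -> 0 < y -> (logQ x <= logQ y) = (x <= y).
Proof. by move=> x0 y0; rewrite ler_pM2r ?invr_gt0 // ler_ln ?posrE. Qed.

Lemma ltr_logQ x y : 0 < x -> 0 < y -> (logQ x < logQ y) = (x < y).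
Proof. by move=> x0 y0; rewrite ltr_pM2r ?invr_gt0 // ltr_ln ?posrE. Qed.

Lemma logQ_inv x n : x * Q ^+ n = 1 -> 0 < x /\ logQ x = - n%:R.
Proof.
move=> E; have Qn : 0 < Q ^+ n by rewrite exprn_gt0.
have xE : x = (Q ^+ n)^-1 by apply: (mulIf (lt0r_neq0 Qn)); rewrite E mulVf // lt0r_neq0.
by rewrite xE invr_gt0 Qn logQV // logQX.
Qed.

Lemma logQ_height (P : {poly {poly F}}) t : P != 0 ->
  0 < powR (height R q P) t /\ logQ (powR (height R q P) t) = t * (lheight P)%:R.
Proof.
by move=> P0; rewrite (heightE R q_gt1 P0) powR_gt0 ?exprn_gt0 // logQ_powR logQX.
Qed.

Variables (xi : L) (PP : nat -> {poly {poly F}}) (al al' : nat -> L) (h e e' : nat -> nat).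
Hypothesis xi1 : abs xi <= 1.
Hypothesis HPP : forall j, quad_approx q iF Tl abs xi (PP j) (al j) (al' j) (h j) (e j) (e' j).
Variables (A w C : R).
Hypothesis HA0 : 0 <= A.
Hypothesis h_unbounded : forall N, exists j, (N <= h j)%N.
Hypothesis e_bounds : forall j,
  (1 + A) * (h j)%:R - C <= (e j)%:R <= (1 + A) * (h j)%:R + C.
Hypothesis w_bounds : forall j,
  w * (h j)%:R - C <= (e j)%:R + (e' j)%:R - (h j)%:R <= w * (h j)%:R + C.

Lemma logQ_dist j : [/\ 0 < abs (xi - al j), logQ (abs (xi - al j)) = - (e j)%:R,
  0 < abs (xi - al' j) & logQ (abs (xi - al' j)) = - (e' j)%:R].
Proof. by case: (HPP j) => _ [_ _ _ /logQ_inv[? ?] /logQ_inv[? ?]]. Qed.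

Lemma logQ_quad j : 0 < abs (pev (PP j) xi) /\
  logQ (abs (pev (PP j) xi)) = (h j)%:R - (e j)%:R - (e' j)%:R.
Proof.
have [d1 l1 d2 l2] := logQ_dist j.
have Qh : 0 < Q ^+ h j by rewrite exprn_gt0.
rewrite (quad_pev (HPP j)) !(absM Habs) (quad_abs_lead Habs q_gt1 (HPP j)) !mulr_gt0 //.
by rewrite !logQM ?mulr_gt0 // l1 l2 logQX.
Qed.

Lemma nat_gt_real (x : R) : exists N : nat, x < N%:R.
Proof. by exists (Num.bound `|x|); apply: le_lt_trans (ler_norm x) _; apply: archi_boundP. Qed.

Lemma large_h (x : R) : exists j, x < (h j)%:R.
Proof.
have [N xN] := nat_gt_real x; have [j Nj] := h_unbounded N.
by exists j; apply: lt_le_trans xN _; rewrite ler_nat.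
Qed.

(** The polynomials [PP j] themselves are the witnesses; the loss [eps] absorbs the constant [C]
    once [h j] exceeds [C / eps]. *)
Lemma w_exp_lower n : (2 <= n)%N -> (w%:E <= w_exp q iF Tl abs n xi)%E.
Proof.
move=> n2; apply/lee_subgt0Pr => eps eps0; apply: ereal_sup_ubound; exists (w - eps) => //.
apply: (unbounded_infinite_set (f := @lheight F)) => N /=.
have [j Hj] := large_h (Num.max N%:R (C / eps)).
rewrite gt_max ltr_nat ltr_pdivrMr // in Hj; case/andP: Hj => jN jC.
have [p1 p2] := logQ_quad j; have s3 := quad_size (HPP j).
have [hp hl] := logQ_height (- (w - eps)) (quad_neq0 (HPP j)).
rewrite (quad_lheight Habs q_gt1 (HPP j)) in hl.
exists (PP j); last by rewrite (quad_lheight Habs q_gt1 (HPP j)) ltnW.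
split; first by rewrite s3.
rewrite p1 /= -ler_logQ // p2 hl; have /andP[w1 _] := w_bounds j.
by move: w1 jC; nra.
Qed.

Lemma wstar_exp_lower n : (2 <= n)%N -> (A%:E <= wstar_exp q iF Tl abs n xi)%E.
Proof.
move=> n2; apply/lee_subgt0Pr => eps eps0; apply: ereal_sup_ubound; exists (A - eps) => //.
(* Infinitely many of the [al j] are distinct because their distances to [xi] become arbitrarily
   small, as measured by the truncated inverse distance. *)
apply: (unbounded_infinite_set (f := fun x => Num.truncn (abs (xi - x))^-1)) => N /=.
have [j Hj] := large_h (Num.max (N%:R + C) (C / eps)).
rewrite gt_max ltr_pdivrMr // in Hj; case/andP: Hj => jN jC.
have [d1 l1 d2 l2] := logQ_dist j; have /andP[w1 _] := e_bounds j.
have [hp hl] := logQ_height (- (A - eps) - 1) (quad_neq0 (HPP j)).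
rewrite (quad_lheight Habs q_gt1 (HPP j)) in hl.
exists (al j).
  exists (PP j); split; [exact: (quad_minpoly Habs q_gt1 (HPP j)) | by rewrite (quad_size (HPP j)) |].
  by rewrite d1 /= -ler_logQ // l1 hl; move: w1 jC; nra.
have -> : (abs (xi - al j))^-1 = (q ^ e j)%:R.
  case: (HPP j) => _ [_ _ _ E1 _]; rewrite natrX; apply: (mulfI (lt0r_neq0 d1)).
  by rewrite E1 mulfV // lt0r_neq0.
rewrite natrK; apply: leq_trans (ltnW (ltn_expl _ q_gt1)).
rewrite -(ler_nat R); have : 0 <= A * (h j)%:R by rewrite mulr_ge0.
have : 0 <= (h j)%:R :> R by [].
by move: w1 jN; lra.
Qed.

Variables (d r : nat).
Hypothesis HA1 : 1 <= A.
Hypothesis HAw : A <= w.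
Hypothesis C0 : 0 <= C.
Hypothesis e'_le : forall j, (e' j <= e j)%N.
Hypothesis h_growth : forall j, (h j.+1)%:R <= r%:R * (h j)%:R + C.
Hypothesis Ad : 0 < A + 1 - d%:R.
Hypothesis gap : 2 * r%:R * d%:R <= (A - 1) * (A + 1 - d%:R).

(** The norm of [P] is a nonzero polynomial, hence at least 1 in absolute value, which bounds
    [P (al j)] from below. The condition on [h j] makes [P xi] closer to [P (al j)] than this bound,
    so both have the same absolute value. *)
Lemma not_root_lower (P : {poly {poly F}}) j : (size P <= d.+1)%N ->
  2 * (lheight P)%:R < (A + 1 - d%:R) * (h j)%:R - C ->
  pev P (al j) != 0 -> pev P (al' j) != 0 ->
  pev P xi != 0 /\ - d%:R * (h j)%:R - (lheight P)%:R <= logQ (abs (pev P xi)).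
Proof.
move=> sP Hj Pa Pa'.
have HP := HPP j; have [al1 al1'] := quad_root_le HP.
have [d1 l1 d2 l2] := logQ_dist j.
have Qh : 0 < Q ^+ h j by rewrite exprn_gt0.
have Ql : 0 < Q ^+ lheight P by rewrite exprn_gt0.
have coefP := abs_coef_le Habs q_gt1 P.
set a := tev (lead_coef (PP j)).
have [z zE] : in_tev iF Tl (a ^+ d * (pev P (al j) * pev P (al' j))).
  apply: norm_tev => //; first exact: in_tev_tev.
    by exists (- (PP j)`_1); rewrite rmorphN /= (quad_coef1 HP) opprK.
  by exists (PP j)`_0; rewrite (quad_coef0 HP).
have X0 : 0 < abs (pev P (al j)) by rewrite (abs_gt0 Habs).
have z0 : z != 0.
  rewrite -(tev_eq0 Habs) // -zE !mulf_neq0 // expf_neq0 // (tev_eq0 Habs) //.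
  exact: (quad_lead_neq0 HP).
have low : - d%:R * (h j)%:R - (lheight P)%:R <= logQ (abs (pev P (al j))).
  have := abs_tev_ge1 Habs q_gt1 z0; rewrite -zE !(absM Habs) (absX Habs).
  rewrite (quad_abs_lead Habs q_gt1 HP) -exprM => H1.
  have : 1 <= Q ^+ (h j * d) * (abs (pev P (al j)) * Q ^+ lheight P).
    apply: le_trans H1 _; rewrite ler_pM2l ?exprn_gt0 // ler_pM2l //.
    by apply: (pev_le Habs) => //; apply: ltW.
  rewrite -(ler_logQ ltr01) ?mulr_gt0 ?exprn_gt0 // !logQM ?mulr_gt0 ?exprn_gt0 // !logQX.
  by rewrite {1}/logQ ln1 mul0r natrM; lra.
have close : abs (pev P xi - pev P (al j)) < abs (pev P (al j)).
  apply: le_lt_trans (pev_lip Habs xi1 al1 (ltW Ql) coefP) _.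
  rewrite -ltr_logQ ?mulr_gt0 // logQM // logQX l1; apply: lt_le_trans low.
  have /andP[e1 _] := e_bounds j.
  by move: Hj e1; nra.
by rewrite -(abs_gt0 Habs) (absB_eq Habs close).
Qed.

(** The index [j] is the first one to which [not_root_lower] applies. If [P] vanishes at a root of
    [PP j], then [PP j] divides it. *)
Lemma dichotomy : exists2 K : R, 0 <= K & forall P : {poly {poly F}}, P != 0 -> (size P <= d.+1)%N ->
  exists j, (exists S, P = PP j * S) \/
    (pev P xi != 0 /\ - A * (lheight P)%:R - K <= logQ (abs (pev P xi))).
Proof.
pose del := A + 1 - d%:R.
exists (d%:R * (h 0)%:R + d%:R * r%:R * C / del + d%:R * C).
  by rewrite !addr_ge0 ?mulr_ge0 ?invr_ge0 // ltW.
move=> P P0 sP.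
have exj : exists j, 2 * (lheight P)%:R < del * (h j)%:R - C.
  have [j Hj] := large_h ((2 * (lheight P)%:R + C) / del); exists j.
  by move: Hj; rewrite ltr_pdivrMr //; lra.
case: (ex_minnP exj) => j Hj minj; exists j.
have [Pa|Pa] := eqVneq (pev P (al j)) 0.
  by left; apply: (quad_dvd Habs q_gt1 (HPP j) _ Pa); left.
have [Pa'|Pa'] := eqVneq (pev P (al' j)) 0.
  by left; apply: (quad_dvd Habs q_gt1 (HPP j) _ Pa'); right.
right; have [-> low] := not_root_lower sP Hj Pa Pa'; split=> //.
apply: le_trans low; have lP : 0 <= (lheight P)%:R :> R by [].
have dC : 0 <= d%:R * C by rewrite mulr_ge0.
have drC : 0 <= d%:R * r%:R * C / del by rewrite !mulr_ge0 // invr_ge0 ltW.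
have d0 : 0 <= d%:R :> R by []. have r0 : 0 <= r%:R :> R by [].
(* For index 0 the term [d h_0] of the constant suffices. For [j.+1], minimality bounds [h j]
   linearly in the height of [P], [h_growth] carries this to [h j.+1], and [gap] says that the slope
   [2 r d / del] is at most [A - 1]. *)
case: j Hj minj Pa Pa' => [|j] Hj minj _ _.
  by have : 0 <= (A - 1) * (lheight P)%:R; [rewrite mulr_ge0 // subr_ge0 | lra].
have hj : del * (h j)%:R <= 2 * (lheight P)%:R + C.
  rewrite leNgt; apply/negP => lt; have /minj : 2 * (lheight P)%:R < del * (h j)%:R - C by lra.
  by rewrite ltnn.
have hj' : (h j)%:R <= (2 * (lheight P)%:R + C) / del by rewrite ler_pdivlMr // mulrC.
have h1 := h_growth j.
have g1 : 2 * r%:R * d%:R / del <= A - 1 by rewrite ler_pdivrMr.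
have s1 : d%:R * (h j.+1)%:R <= d%:R * r%:R * ((2 * (lheight P)%:R + C) / del) + d%:R * C.
  rewrite -mulrA -mulrDr ler_wpM2l //; apply: le_trans h1 _.
  by rewrite lerD2r ler_wpM2l.
have s2 : d%:R * r%:R * ((2 * (lheight P)%:R + C) / del)
   = (2 * r%:R * d%:R / del) * (lheight P)%:R + d%:R * r%:R * C / del by ring.
have s3 : (2 * r%:R * d%:R / del) * (lheight P)%:R <= (A - 1) * (lheight P)%:R by rewrite ler_wpM2r.
have s4 : 0 <= d%:R * (h 0)%:R :> R by rewrite mulr_ge0.
by lra.
Qed.

(** Induction on the degree: splitting off a factor [PP j] adds the logarithms of the values and, by
    [quad_lheightM], costs nothing in height. The term [K * size P] pays for one constant per
    factor, and [A <= w] covers the other case. *)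
Lemma pev_lower : exists2 K : R, 0 <= K &
  forall P : {poly {poly F}}, P != 0 -> (size P <= d.+1)%N ->
  pev P xi != 0 /\
  - w * (lheight P)%:R - K * (size P)%:R <= logQ (abs (pev P xi)).
Proof.
have [K0 K00 HK0] := dichotomy.
exists (K0 + C) => [|P]; first by rewrite addr_ge0.
have w0 : 0 <= w by move: HA1 HAw; lra.
elim: {P}(size P).+1 {-2}P (ltnSn (size P)) => // n IH P sn P0 sP.
have sP1 : 1 <= (size P)%:R :> R by rewrite ler1n size_poly_gt0.
have [j [[S PE]|[-> low]]] := HK0 P P0 sP; last first.
  split=> //; apply: le_trans low.
  have h1 : A * (lheight P)%:R <= w * (lheight P)%:R by rewrite ler_wpM2r.
  have h2 : (K0 + C) * 1 <= (K0 + C) * (size P)%:R by rewrite ler_wpM2l // addr_ge0.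
  by move: h1 h2 C0; lra.
have S0 : S != 0 by apply: contraNneq P0 => S0; rewrite PE S0 mulr0.
have sPS : size P = (size S).+2.
  by rewrite PE size_mul ?(quad_neq0 (HPP j)) // (quad_size (HPP j)).
have [||Sx Sl] := IH S _ S0.
- by move: sn; rewrite sPS => /ltnSE /ltnW.
- by move: sP; rewrite sPS => H; rewrite (leq_trans _ H) // -addn2 leq_addr.
have [p1 p2] := logQ_quad j; have /andP[_ wb] := w_bounds j.
have sx : 0 < abs (pev S xi) by rewrite (abs_gt0 Habs).
have hM : (h j)%:R + (lheight S)%:R <= (lheight P)%:R :> R.
  by rewrite -natrD ler_nat PE (quad_lheightM Habs q_gt1 (HPP j)).
have PxE : abs (pev P xi) = abs (pev (PP j) xi) * abs (pev S xi).
  by rewrite [in LHS]PE pevM (absM Habs).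
rewrite -(abs_gt0 Habs) PxE mulr_gt0 // logQM // p2; split=> //.
have h1 : w * ((h j)%:R + (lheight S)%:R) <= w * (lheight P)%:R by rewrite ler_wpM2l.
have -> : (size P)%:R = (size S)%:R + 2 :> R by rewrite sPS -addn2 natrD.
by move: Sl wb h1 K00 C0; lra.
Qed.

Lemma finite_lheight n (E : set {poly {poly F}}) (N : R) :
  (forall P, E P -> (size P <= n)%N /\ (lheight P)%:R <= N) -> finite_set E.
Proof.
move=> H; have [M NM] := nat_gt_real N.
apply: sub_finite_set (finite_bounded_polys F n M.+1) => P /H[sP lP]; split=> // i.
have lM : (lheight P < M)%N by rewrite -(ltr_nat R); apply: le_lt_trans NM.
have [iP|/leq_sizeP->//] := ltnP i (size P); last by rewrite size_poly0.
have : ((size (P`_i)%R).-1 <= lheight P)%N by apply: (bigop.leq_bigmax (Ordinal iP)).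
case: (size _) => // m /= H1; apply: ltnW; rewrite ltnS.
exact: leq_ltn_trans H1 lM.
Qed.

Lemma w_exp_upper n : (n <= d)%N -> (w_exp q iF Tl abs n xi <= w%:E)%E.
Proof.
move=> nd; have [K K0 HK] := pev_lower.
apply: ge_ereal_sup => _ [w' Hw' <-]; rewrite lee_fin leNgt; apply/negP => ww'.
apply: Hw'; apply: (@finite_lheight n.+1 _ (K * d.+1%:R / (w' - w))) => P /= [sP].
case/andP => P0 Pw; split=> //.
have Pn0 : P != 0 by apply/eqP => PE; move: P0; rewrite PE pev0 (abs0 Habs) ltxx.
have sPd : (size P <= d.+1)%N by apply: leq_trans sP _.
have [_ low] := HK P Pn0 sPd.
have [h1 h2] := logQ_height (- w') Pn0.
rewrite -ler_logQ // h2 in Pw.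
have KP : K * (size P)%:R <= K * d.+1%:R by rewrite ler_wpM2l // ler_nat.
rewrite ler_pdivlMr ?subr_gt0 //; move: low Pw KP.
set x := lheight P; by lra.
Qed.

(** A minimal polynomial is irreducible, so [dichotomy] applies without induction and gives [A]
    instead of [w]. If [PP j] divides it, the number is [al j] or [al' j], at distance at least
    [Q^-(e j)]. Otherwise the value at [xi] is at most the height times the distance. *)
Lemma wstar_exp_upper n : (n <= d)%N -> (wstar_exp q iF Tl abs n xi <= A%:E)%E.
Proof.
move=> nd; have [K K0 HK] := dichotomy.
apply: ge_ereal_sup => _ [w' Hw' <-]; rewrite lee_fin leNgt; apply/negP => Aw'.
apply: Hw'.
pose E := [set P : {poly {poly F}} | [/\ P != 0, (size P <= n.+1)%N &
  (lheight P)%:R <= (K + C) / (w' - A)]]%classic.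
have finE : finite_set E by apply: (@finite_lheight n.+1 _ ((K + C) / (w' - A))) => P [].
apply: (@sub_finite_set _ _ (\bigcup_(P in E) [set x | root (map_poly tev P) x])%classic); last first.
  apply: bigcup_finite finE _ => P [P0 _ _]; apply: finite_roots.
  apply: contraNneq P0 => PE; apply/eqP/polyP => i; rewrite coef0; apply/eqP.
  by rewrite -(tev_eq0 Habs) // -coef_map PE coef0.
move=> a /= [P [Pmin sP /andP[a0 aw]]]; exists P; last first.
  by case: Pmin => _ _ _ _ Pa; apply/rootP.
case: Pmin => sP1 irr _ _ Pa.
have P0 : P != 0 by rewrite -size_poly_gt0 ltnW.
split=> //; have w0 : 0 <= w' + 1 by move: HA1 Aw'; lra.
have [h1 h2] := logQ_height (- w' - 1) P0.
have lP : 0 <= (lheight P)%:R :> R by [].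
(* The Lipschitz bound requires this; it holds because [a] is within distance 1 of [xi]. *)
have a1 : abs a <= 1.
  have xa : abs (xi - a) <= 1.
    apply: le_trans aw _; rewrite -ler_logQ // h2 {1}/logQ ln1 mul0r.
    by have := mulr_ge0 w0 lP; lra.
  have -> : a = xi - (xi - a) by rewrite subKr.
  exact: (absB_le Habs).
rewrite -ler_logQ // h2 in aw.
have sPd : (size P <= d.+1)%N by apply: leq_trans sP _.
rewrite ler_pdivlMr ?subr_gt0 //.
have [j [[S PE]|[Px low]]] := HK P P0 sPd; last first.
  have Ql : 0 < Q ^+ lheight P by rewrite exprn_gt0.
  have := pev_lip Habs xi1 a1 (ltW Ql) (abs_coef_le Habs q_gt1 P).
  have px : 0 < abs (pev P xi) by rewrite (abs_gt0 Habs).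
  rewrite Pa subr0 -ler_logQ ?mulr_gt0 // logQM // logQX.
  by move: C0; lra.
have S0 : S != 0 by apply: contraNneq P0 => S0; rewrite PE S0 mulr0.
have dvd : PP j %| P by rewrite PE dvdp_mulr.
have eqvP : PP j %= P by apply: irr.2 dvd; rewrite (quad_size (HPP j)).
have sS : size S = 1%N.
  have := eqp_size eqvP; rewrite {1}PE size_mul ?(quad_neq0 (HPP j)) // (quad_size (HPP j)).
  by case: (size S) => [|[|m]].
have /size_poly1P[c c0 cS] : size S == 1%N by rewrite sS.
have ra : a = al j \/ a = al' j.
  apply: (quad_root Habs q_gt1 (HPP j)); move: Pa; rewrite PE pevM cS pevC => /eqP.
  by rewrite mulf_eq0 (tev_eq0 Habs) // (negbTE c0) orbF => /eqP.
have hP : (h j)%:R <= (lheight P)%:R :> R.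
  by rewrite ler_nat PE; apply: leq_trans (quad_lheightM Habs q_gt1 (HPP j) S0); rewrite leq_addr.
have [d1 l1 d2 l2] := logQ_dist j.
have ea : - (e j)%:R <= logQ (abs (xi - a)).
  by case: ra => ->; rewrite ?l1 ?l2 // lerN2 ler_nat.
have /andP[_ eb] := e_bounds j.
have : (1 + A) * (h j)%:R <= (1 + A) * (lheight P)%:R by rewrite ler_wpM2l //; move: HA1; lra.
by move: K0; lra.
Qed.

End Exponents.

(** * Continued fraction expansions and words *)

Section Expansion.
Variables (R : realType) (F : finFieldType) (L : closedFieldType).
Variables (q : nat) (iF : {rmorphism F -> L}) (Tl : L) (abs : L -> R).
Hypotheses (Habs : is_ext_abs q iF Tl abs) (q_gt1 : (1 < q)%N).

Local Notation Q := (q%:R : R).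
Local Notation tev := (tev iF Tl).
Local Notation lt := (fun c => iF c * Tl).
Local Notation mob := (mob iF Tl).
Let Q1 : 1 < Q := Q_gt1 R q_gt1.
Let Q0 : 0 < Q := Q_gt0 R q_gt1.
Let Qn0 : Q != 0 := Q_neq0 R q_gt1.

Lemma mkseq_cons (T : Type) (f : nat -> T) n : mkseq f n.+1 = f 0%N :: mkseq (f \o succn) n.
Proof. by rewrite /mkseq /= (iotaDl 1 0) -map_comp. Qed.

Lemma abs_lt c : c != 0 -> abs (lt c) = Q.
Proof. by move=> c0; rewrite (absM Habs) (abs_iF Habs c0) mul1r (absT Habs). Qed.

Definition expansion (c : nat -> F) (x : L) := forall eps : R, 0 < eps ->
  exists N, forall n, (N <= n)%N -> abs (x - mob (mkseq c n) (lt (c n))) < eps.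

Lemma notin_mkseq (c : nat -> F) n : (forall i, c i != 0) -> 0 \notin mkseq c n.
Proof. by move=> c0; apply/mapP => -[i _ /esym/eqP]; rewrite (negbTE (c0 i)). Qed.

Lemma expansion_abs c x : (forall i, c i != 0) -> expansion c x -> abs x = Q.
Proof.
move=> c0 /(_ Q Q0)[N /(_ N (leqnn N)) H].
have vQ : abs (mob (mkseq c N) (lt (c N))) = Q.
  by apply: (abs_mob Habs q_gt1); [exact: notin_mkseq | exact: abs_lt].
by rewrite -vQ; apply: (absB_eq Habs); rewrite vQ.
Qed.

(** Removing the first letter and inverting multiplies distances by [Q ^+ 2], so convergence is
    preserved. *)
Lemma expansion_step c x : (forall i, c i != 0) -> expansion c x ->
  expansion (c \o succn) (x - lt (c 0%N))^-1.
Proof.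
move=> c0 H; set y := x - _.
have vQ n : abs (mob (mkseq (c \o succn) n) (lt (c n.+1))) = Q.
  apply: (abs_mob Habs q_gt1); [apply: notin_mkseq => i; exact: c0 | exact: abs_lt].
have E n : x - mob (mkseq c n.+1) (lt (c n.+1))
           = y - (mob (mkseq (c \o succn) n) (lt (c n.+1)))^-1.
  by rewrite mkseq_cons /= /y opprD addrA.
have yQ : abs y^-1 = Q.
  have [|N /(_ N.+1 (leqnSn N))] := H Q^-1; first by rewrite invr_gt0.
  rewrite E => HN; rewrite (absV Habs).
  rewrite (absB_eq Habs (y := (mob (mkseq (c \o succn) N) (lt (c N.+1)))^-1)).
    by rewrite (absVQ Habs) // invrK.
  by rewrite (absVQ Habs (vQ N)).
move=> eps eps0; have [|N HN] := H (eps / Q ^+ 2).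
  by rewrite divr_gt0 // exprn_gt0.
exists N => n nN; have := HN n.+1 (leqW nN).
by rewrite E ltr_pdivlMr ?exprn_gt0 // -{1}(invrK y) (abs_subV Habs q_gt1 yQ (vQ n)).
Qed.

Lemma expansion_mob c x n : (forall i, c i != 0) -> expansion c x ->
  exists2 y, abs y = Q & x = mob (mkseq c n) y.
Proof.
elim: n c x => [|n IH] c x c0 H; first by exists x => //; apply: expansion_abs H.
have [|y yQ yE] := IH _ _ _ (expansion_step c0 H); first by move=> i; apply: c0.
by exists y => //; rewrite mkseq_cons /= -yE invrK addrC subrK.
Qed.

(** As the partial quotient of index 0 is 0, the convergents of [xi] are the inverses of the finite
    continued fractions in the letters [c]; hence the inverse of [xi]. *)
Lemma cf_value_expansion (a : nat -> {poly F}) (c : nat -> F) xi :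
  a 0%N = 0 -> (forall i, a i.+1 = c i *: 'X) -> (forall i, c i != 0) ->
  cf_value iF Tl abs a xi -> expansion c xi^-1.
Proof.
move=> a0 ac c0 H.
have vQ n : abs (mob (mkseq c n) (lt (c n))) = Q.
  by apply: (abs_mob Habs q_gt1); [exact: notin_mkseq | exact: abs_lt].
have E n : tev (cf_num a n.+1) / tev (cf_den a n.+1) = (mob (mkseq c n) (lt (c n)))^-1.
  rewrite /cf_num /cf_den (cf_pq_word n.+1 a0 ac) /= mkseqS !word_mx_rcons.
  have [D1 D2] := mob_mx Habs q_gt1 (notin_mkseq n c0) (abs_lt (c0 n)).
  rewrite !rmorphD !rmorphM /= tevZ tevX -D2 invfM mulrCA mulfV ?mulr1 //.
  by rewrite -(abs_eq0 Habs) D1 expf_neq0.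
have xQ : abs xi^-1 = Q.
  have [|N /(_ N.+1 (leqnSn N))] := H Q^-1; first by rewrite invr_gt0.
  rewrite E => HN; rewrite (absV Habs).
  rewrite (absB_eq Habs (y := (mob (mkseq c N) (lt (c N)))^-1)).
    by rewrite (absVQ Habs) // invrK.
  by rewrite (absVQ Habs (vQ N)).
move=> eps eps0; have [|N HN] := H (eps / Q ^+ 2).
  by rewrite divr_gt0 // exprn_gt0.
exists N => n nN; have := HN n.+1 (leqW nN).
by rewrite E ltr_pdivlMr ?exprn_gt0 // -{1}(invrK xi) (abs_subV Habs q_gt1 xQ (vQ n)).
Qed.

End Expansion.

Section AlternatingWords.
Variable T : eqType.
Implicit Types (x y z : T).

Fixpoint altw x y n : seq T := if n is n'.+1 then x :: altw y x n' else [::].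

Lemma size_altw x y n : size (altw x y n) = n.
Proof. by elim: n x y => //= n IH x y; rewrite IH. Qed.

Lemma altw_add x y m n :
  altw x y (m + n)%N = altw x y m ++ (if odd m then altw y x n else altw x y n).
Proof. by elim: m x y => //= m IH x y; rewrite IH; case: (odd m). Qed.

Lemma altwS x y n : altw x y n.+1 = rcons (altw x y n) (if odd n then y else x).
Proof. by rewrite -addn1 altw_add -cats1; case: (odd n). Qed.

Lemma altw_power x y n : flatten (nseq n [:: x; y]) = altw x y (2 * n)%N.
Proof.
elim: n => [|n IH]; first by rewrite muln0.
have -> : (2 * n.+1 = (2 * n).+2)%N by rewrite mulnS.
by rewrite /= -IH.
Qed.

Lemma rev_altw x y n : rev (altw x y n) = if odd n then altw x y n else altw y x n.
Proof.
elim: n x y => [|n IH] x y //.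
have -> : rev (altw x y n.+1) = rcons (rev (altw y x n)) x by rewrite -rev_cons.
by rewrite IH !altwS /=; case: (odd n).
Qed.

Lemma notin_altw x y z n : z != x -> z != y -> z \notin altw x y n.
Proof.
by elim: n x y => //= n IH x y zx zy; rewrite inE negb_or zx IH.
Qed.

Lemma nseq_altw x n : nseq n x = altw x x n.
Proof. by elim: n => //= n ->. Qed.

Lemma flatten_nseqSr (s : seq T) n : flatten (nseq n.+1 s) = flatten (nseq n s) ++ s.
Proof. by elim: n => [|n IH] /=; rewrite ?cats0 // -catA -IH. Qed.

Lemma power_rotate (s t : seq T) n :
  s ++ flatten (nseq n (t ++ s)) = flatten (nseq n (s ++ t)) ++ s.
Proof. by elim: n => [|n IH] /=; rewrite ?cats0 // -!catA IH. Qed.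

End AlternatingWords.

(** * Common divisors of the coefficients attached to a period *)

Section Content.
Variable F : fieldType.
Implicit Types (c : F) (u v w : seq F).

(** For a palindrome [v] the two entries are [c X a + b] and [X a + b]. As [c != 1], [g] divides
    [X a] and [b], and expanding the determinant shows that it divides [X]. *)
Lemma palindrome_content v c (g : {poly F}) : rev v = v -> c != 1 ->
  let M := word_mx (1 :: rcons v c) in
  g %| M 1 0 -> g %| M 0 1 -> (size g <= 2)%N.
Proof.
move=> rv c1 /=; rewrite !word_mx_cons !word_mx_rcons scale1r.
set a := word_mx v 0 0; set b := word_mx v 0 1.
have -> : word_mx v 1 0 = b by rewrite -word_mx_rev rv.
move=> g1 g2.
have gXa : g %| 'X * a.
  have c10 : c - 1 != 0 by rewrite subr_eq0.
  rewrite -(dvdpZr _ _ c10); have -> : (c - 1) *: ('X * a) = a * (c *: 'X) + b - ('X * a + b).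
    by rewrite -!mul_polyC rmorphB; ring.
  exact: dvdp_sub.
have gb : g %| b by rewrite -(dvdp_addr _ gXa).
have gX : g %| (-1) ^+ size v * 'X.
  rewrite -word_mx_det -/a -/b.
  have -> : (a * word_mx v 1 1 - b * word_mx v 1 0) * 'X
     = ('X * a) * word_mx v 1 1 - b * (word_mx v 1 0 * 'X) by ring.
  by rewrite dvdp_sub // dvdp_mulr.
have nX : (-1) ^+ size v * 'X != 0 :> {poly F}.
  by rewrite mulf_neq0 ?polyX_eq0 // signr_eq0.
apply: leq_trans (dvdp_leq nX gX) _.
by rewrite -signr_odd; case: (odd _); rewrite ?expr1 ?mulN1r ?size_polyN ?mul1r size_polyX.
Qed.

(* The words [u ++ v] and [v ++ u] have conjugate matrices. *)
Lemma rotate_content u v (g : {poly F}) :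
  let M := word_mx (u ++ v) in let N := word_mx (v ++ u) in
  g %| M 1 0 -> g %| M 0 1 -> g %| M 0 0 - M 1 1 -> g %| N 1 0 /\ g %| N 0 1.
Proof.
move=> M N g1 g2 g3; pose S := word_mx u.
have E i j : S i 0 * N 0 j + S i 1 * N 1 j = M i 0 * S 0 j + M i 1 * S 1 j.
  by rewrite -!word_mx_cat catA.
have e2 : (S 0 0 * S 1 1 - S 0 1 * S 1 0) ^+ 2 = 1 by rewrite word_mx_det sqrr_sign.
set e := S 0 0 * S 1 1 - S 0 1 * S 1 0 in e2.
have H x : g %| e * x -> g %| x.
  by move=> gx; rewrite -[x]mul1r -e2 expr2 -mulrA dvdp_mull.
have D x y z : g %| x * M 1 0 + y * M 0 1 + z * (M 0 0 - M 1 1).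
  by rewrite !dvdp_add ?dvdp_mull.
split; apply: H.
- have -> : e * N 1 0 = S 0 0 * (S 1 0 * N 0 0 + S 1 1 * N 1 0)
     - S 1 0 * (S 0 0 * N 0 0 + S 0 1 * N 1 0) by rewrite /e; ring.
  rewrite !E; have -> : S 0 0 * (M 1 0 * S 0 0 + M 1 1 * S 1 0) - S 1 0 * (M 0 0 * S 0 0 + M 0 1 * S 1 0)
    = (S 0 0 ^+ 2) * M 1 0 + - (S 1 0 ^+ 2) * M 0 1 + - (S 0 0 * S 1 0) * (M 0 0 - M 1 1) by ring.
  exact: D.
- have -> : e * N 0 1 = S 1 1 * (S 0 0 * N 0 1 + S 0 1 * N 1 1)
     - S 0 1 * (S 1 0 * N 0 1 + S 1 1 * N 1 1) by rewrite /e; ring.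
  rewrite !E; have -> : S 1 1 * (M 0 0 * S 0 1 + M 0 1 * S 1 1) - S 0 1 * (M 1 0 * S 0 1 + M 1 1 * S 1 1)
    = - (S 0 1 ^+ 2) * M 1 0 + (S 1 1 ^+ 2) * M 0 1 + (S 0 1 * S 1 1) * (M 0 0 - M 1 1) by ring.
  exact: D.
Qed.

End Content.

(** * The expansion of Theta *)

Section ThetaWords.
Variables (F : finFieldType) (p r k : nat) (lam : F).
Hypotheses (odd_r : odd r = (p != 2%N)) (r_gt1 : (1 < r)%N).

(** Taking [mu = lam] for [p = 2] gives the blocks the same alternating form in every
    characteristic. *)
Definition theta_mu := if p != 2%N then 2 - lam else lam.
Local Notation mu := theta_mu.
Hypotheses (lam0 : lam != 0) (mu0 : mu != 0) (mu1 : mu != 1).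

Definition theta_word i : seq F := flatten (nseq k.+1 (1 :: altw lam mu (r ^ i - 1)%N)).

Definition theta_prefix J : seq F := nseq k 1 ++ flatten [seq theta_word i | i <- iota 1 J].

(** Any prefix with more than [n] letters would give the same letter; [n.+2] matches the truncation
    in [inf_word] at index [n.+1]. *)
Definition theta_letter n : F := nth 0 (theta_prefix n.+2) n.

Lemma rX_gt0 i : (0 < r ^ i)%N.
Proof. by rewrite expn_gt0 ltnW. Qed.

Lemma map_altw (S T : eqType) (f : S -> T) x y n : map f (altw x y n) = altw (f x) (f y) n.
Proof. by elim: n x y => //= n IH x y; rewrite IH. Qed.

Lemma theta_blockE i : (0 < i)%N ->
  theta_block p r k lam i = [seq c *: 'X | c <- theta_word i].
Proof.
move=> i0; rewrite /theta_block /theta_word /theta_mu map_flatten map_nseq /= scale1r map_altw.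
case: ifP => [p2|_]; last by rewrite nseq_altw.
rewrite altw_power mulnC divnK // dvdn2 oddB ?rX_gt0 // oddX odd_r p2 orbT //.
Qed.

Lemma theta_prefixS J : theta_prefix J.+1 = theta_prefix J ++ theta_word J.+1.
Proof. by rewrite /theta_prefix -[in LHS](addn1 J) iotaD map_cat flatten_cat /= cats0 catA. Qed.

Lemma size_theta_word i : size (theta_word i) = (k.+1 * r ^ i)%N.
Proof. by rewrite size_power /= size_altw subnSK ?rX_gt0 // subn0. Qed.

Lemma size_theta_prefix J : (J <= size (theta_prefix J))%N.
Proof.
elim: J => // J IH; rewrite theta_prefixS size_cat size_theta_word.
by apply: leq_trans (leq_add IH (_ : 1 <= _)%N); rewrite ?addn1 // muln_gt0 rX_gt0.
Qed.

Lemma theta_prefix_cat m n : exists s, theta_prefix (m + n)%N = theta_prefix m ++ s.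
Proof.
elim: n => [|n [s IH]]; first by exists [::]; rewrite addn0 cats0.
by exists (s ++ theta_word (m + n).+1); rewrite addnS theta_prefixS IH catA.
Qed.

Lemma theta_letter_prefix J n : (n < size (theta_prefix J))%N ->
  theta_letter n = nth 0 (theta_prefix J) n.
Proof.
move=> nJ; rewrite /theta_letter; case: (leqP J n.+2) => H.
  by have [s] := theta_prefix_cat J (n.+2 - J); rewrite subnKC // => ->; rewrite nth_cat nJ.
have [s] := theta_prefix_cat n.+2 (J - n.+2); rewrite subnKC 1?ltnW // => ->.
by rewrite [in RHS]nth_cat (leq_trans (leqnSn _) (size_theta_prefix n.+2)).
Qed.

Lemma mkseq_theta J s t : theta_prefix J = s ++ t -> mkseq theta_letter (size s) = s.
Proof.
move=> E; apply: (@eq_from_nth _ 0); rewrite size_mkseq // => i si.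
rewrite nth_mkseq // (@theta_letter_prefix J) E ?nth_cat ?si //.
by rewrite size_cat ltn_addr.
Qed.

Lemma notin_theta_prefix J : 0 \notin theta_prefix J.
Proof.
elim: J => [|J IH].
  by rewrite /theta_prefix /= cats0; apply/negP => /nseqP[/esym/eqP]; rewrite oner_eq0.
rewrite theta_prefixS mem_cat negb_or IH; apply: notin_power.
by rewrite inE negb_or eq_sym oner_eq0 notin_altw // eq_sym.
Qed.

Lemma theta_letter_neq0 n : theta_letter n != 0.
Proof.
have lt : (n < size (theta_prefix n.+2))%N by apply: leq_trans (size_theta_prefix _).
by apply: contraNneq (notin_theta_prefix n.+2) => <-; rewrite mem_nth.
Qed.

Lemma theta_pqE n : theta_pq p r k lam n.+1 = theta_letter n *: 'X.
Proof.
have lt : (n < size (theta_prefix n.+2))%N by apply: leq_trans (size_theta_prefix _).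
have E : nseq k 'X ++ flatten [seq theta_block p r k lam i | i <- iota 1 n.+2]
         = [seq c *: 'X | c <- theta_prefix n.+2].
  rewrite /theta_prefix map_cat map_nseq scale1r map_flatten -map_comp.
  congr (_ ++ flatten _); apply/eq_in_map => i; rewrite mem_iota => /andP[i0 _].
  exact: theta_blockE.
change (theta_pq p r k lam n.+1) with
  (nth 0 (nseq k 'X ++ flatten [seq theta_block p r k lam i | i <- iota 1 n.+2]) n).
by rewrite E (nth_map 0).
Qed.

(** The displayed final 1 is where the expansion leaves the period [lam mu]. Two blocks are taken
    because for [k = 0] this letter already belongs to block [J + 2]. *)
Lemma theta_prefix_block J : exists t, theta_prefix J.+2 =
  (rcons (theta_prefix J) 1 ++ rcons (altw lam mu (r ^ J.+1 - 1)%N) 1) ++ t.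
Proof.
rewrite !theta_prefixS /theta_word; move: (theta_prefix J) => P.
set b := altw _ _ _; set b' := altw _ _ _.
have [t tE] : exists t,
    flatten (nseq k.+1 (1 :: b)) ++ flatten (nseq k.+1 (1 :: b')) = 1 :: b ++ 1 :: t.
  by rewrite /=; case: k => [|k']; eexists; rewrite /= -?catA.
by exists t; rewrite -catA tE -!cats1 -!catA.
Qed.

Section RotatedPeriod.
Variable J : nat.
Let D := (r ^ J.+1 - 1)%N.
Let E := (r ^ J.+2 - r ^ J.+1)%N.

Let DE : (r ^ J.+2 - 1 = E + D)%N.
Proof. by rewrite /E /D addnBA ?rX_gt0 // subnK // leq_exp2l. Qed.

Let E_gt0 : (0 < E)%N.
Proof. by rewrite subn_gt0 ltn_exp2l. Qed.

(** Evenness makes the alternation restart with [lam] after [E] letters, so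
    [altw lam mu E ++ altw lam mu D] is again alternating. *)
Let E_even : odd E = false.
Proof. by rewrite oddB ?leq_exp2l // !oddX /= addbb. Qed.

(* A rotation of the word [1 :: altw lam mu (r ^ J.+2 - 1)] repeated in block J + 2. *)
Definition theta_period := altw lam mu D ++ 1 :: altw lam mu E.
(** All the letters before the last letter 1 of block [J + 1]. *)
Definition theta_head := theta_prefix J ++ flatten (nseq k (1 :: altw lam mu D)).
(** The period persists through block [J + 2] and the first [r ^ J.+2] letters of block [J + 3];
    there it continues with 1, whereas the expansion has [theta_break]. *)
Definition theta_overlap := flatten (nseq k.+2 theta_period) ++ altw lam mu D.
Definition theta_break := if odd (r ^ J.+2 - 1) then mu else lam.

Lemma theta_prefix_overlap : exists t, theta_prefix J.+3 =
  (rcons theta_head 1 ++ rcons theta_overlap theta_break) ++ t.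
Proof.
have lt : (r ^ J.+2 - 1 < r ^ J.+3 - 1)%N.
  by rewrite ltn_sub2r ?ltn_exp2l // -{1}(expn0 r) ltn_exp2l.
have [t tE] : exists t, theta_word J.+3 = 1 :: altw lam mu E ++ altw lam mu D ++ theta_break :: t.
  have [m mE] : exists m, (r ^ J.+3 - 1 = (r ^ J.+2 - 1) + m.+1)%N.
    by exists (r ^ J.+3 - 1 - (r ^ J.+2 - 1)).-1; rewrite prednK ?subn_gt0 // subnKC // ltnW.
  have [t tE] : exists t, (if odd (r ^ J.+2 - 1) then altw mu lam m.+1 else altw lam mu m.+1)
      = theta_break :: t by rewrite /theta_break; case: (odd _); eexists.
  exists (t ++ flatten (nseq k (1 :: altw lam mu (r ^ J.+3 - 1)%N))).
  by rewrite /theta_word /= {1}mE altw_add tE DE altw_add E_even /= -!catA.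
exists t; rewrite !theta_prefixS tE /theta_word /theta_head; move: (theta_prefix J) => P.
rewrite DE altw_add E_even -/D -cat_cons.
rewrite (flatten_nseqSr _ k) -[in LHS]catA.
set a := altw lam mu D; set b := altw lam mu E; set f := flatten (nseq k _).
have -> : theta_overlap = flatten (nseq k.+1 (a ++ 1 :: b)) ++ a ++ 1 :: b ++ a.
  by rewrite /theta_overlap /theta_period flatten_nseqSr -!catA.
have := power_rotate a (1 :: b) k.+1; move: (flatten (nseq k.+1 _)) (flatten (nseq k.+1 _)) => g g' gE.
by rewrite -!cats1 -!catA /= -!catA /= (catA a g') gE -!catA.
Qed.

Lemma altw_E : altw lam mu E = rcons (altw lam mu E.-1) mu.
Proof.
by move: E_gt0 E_even; case: E => // n _; rewrite oddS => /negbFE on; rewrite altwS on.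
Qed.

Lemma theta_periodE : theta_period = rcons (altw lam mu D ++ 1 :: altw lam mu E.-1) mu.
Proof. by rewrite /theta_period altw_E -rcons_cons rcons_cat. Qed.

(** Rotating the period back to [1 :: altw lam mu (r ^ J.+2 - 1)] leaves, between 1 and the final
    [mu], a palindrome: its length is odd, or [mu = lam]. *)
Lemma theta_period_content : bounded_content theta_period.
Proof.
move=> g g1 g2 g3; have [h1 h2] := rotate_content g1 g2 g3.
have Wm : (1 :: altw lam mu E) ++ altw lam mu D = 1 :: altw lam mu (r ^ J.+2 - 1)%N.
  by rewrite DE altw_add E_even.
rewrite Wm in h1 h2.
have [n nE] : exists n, (r ^ J.+2 - 1 = n.+1)%N by exists (E.-1 + D)%N; rewrite DE -addSn prednK.
have [n_odd|mul] : odd n \/ mu = lam.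
  rewrite /theta_mu; case: ifP => [p2|]; [left | by right].
  have : odd n.+1 = false by rewrite -nE oddB ?rX_gt0 // oddX odd_r p2.
  by rewrite oddS => /negbFE.
- apply: palindrome_content mu1 (_ : g %| word_mx (1 :: rcons (altw lam mu n) mu) 1 0) _;
    first by rewrite rev_altw n_odd.
    by move: h1; rewrite nE altwS n_odd.
  by move: h2; rewrite nE altwS n_odd.
- apply: palindrome_content mu1 (_ : g %| word_mx (1 :: rcons (altw lam mu n) mu) 1 0) _;
    first by rewrite rev_altw mul; case: ifP.
    by move: h1; rewrite nE altwS mul; case: ifP.
  by move: h2; rewrite nE altwS mul; case: ifP.
Qed.

Lemma size_theta_period : size theta_period = (r ^ J.+2)%N.
Proof. by rewrite size_cat /= !size_altw addnS addnC -DE subn1 prednK ?rX_gt0. Qed.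

Lemma size_theta_overlap : size theta_overlap = (k.+2 * r ^ J.+2 + (r ^ J.+1 - 1))%N.
Proof. by rewrite size_cat size_power size_theta_period size_altw. Qed.

Lemma size_theta_head : size theta_head = (size (theta_prefix J) + k * r ^ J.+1)%N.
Proof. by rewrite size_cat size_power /= size_altw /D subn1 prednK ?rX_gt0. Qed.

Lemma notin_theta_head : 0 \notin theta_head.
Proof.
rewrite mem_cat negb_or notin_theta_prefix; apply: notin_power.
by rewrite inE negb_or eq_sym oner_eq0 notin_altw // eq_sym.
Qed.

Lemma notin_theta_period : 0 \notin theta_period.
Proof.
have altw0 n : 0 \notin altw lam mu n by rewrite notin_altw // eq_sym.
by rewrite mem_cat inE !negb_or eq_sym oner_eq0 !altw0.
Qed.

Lemma theta_overlap_power :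
  flatten (nseq k.+3 theta_period) = theta_overlap ++ 1 :: altw lam mu E.
Proof. by rewrite flatten_nseqSr {2}/theta_period catA. Qed.

End RotatedPeriod.

End ThetaWords.

(** * Quadratic approximations to Theta *)

Section ThetaApprox.
Variables (R : realType) (F : finFieldType) (L : closedFieldType).
Variables (q : nat) (iF : {rmorphism F -> L}) (Tl : L) (abs : L -> R).
Hypotheses (Habs : is_ext_abs q iF Tl abs) (q_gt1 : (1 < q)%N).
Variables (p r k : nat) (lam : F) (xi : L).
Hypotheses (odd_r : odd r = (p != 2%N)) (r_gt1 : (1 < r)%N).
Local Notation mu := (theta_mu p lam).
Hypotheses (lam0 : lam != 0) (lam1 : lam != 1) (mu0 : mu != 0) (mu1 : mu != 1).
Hypothesis Hxi : cf_value iF Tl abs (theta_pq p r k lam) xi.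
Local Notation Q := (q%:R : R).
Local Notation prefix := (theta_prefix p r k lam).

Lemma theta_mob J s t : prefix J = s ++ t ->
  exists2 y, abs y = Q & xi = (mob iF Tl s y)^-1.
Proof.
move=> E; have c0 := theta_letter_neq0 k r_gt1 lam0 mu0.
have H := cf_value_expansion Habs q_gt1 (erefl : theta_pq p r k lam 0%N = 0)
  (theta_pqE k lam odd_r r_gt1) c0 Hxi.
have [y yQ yE] := expansion_mob Habs q_gt1 (size s) c0 H.
by exists y => //; rewrite -(invrK xi) yE (mkseq_theta r_gt1 E).
Qed.

Lemma theta_abs_le1 : abs xi <= 1.
Proof.
have [y yQ ->] := theta_mob (erefl : prefix 0 = [::] ++ prefix 0).
by rewrite /= (absVQ Habs yQ) invf_le1 ?ler1n ?ltr0n ltnW // ltnW.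
Qed.

Lemma altw_neq1 n : (if odd n then mu else lam) != 1.
Proof. by case: ifP. Qed.

Lemma altw_neq0 n : (if odd n then mu else lam) != 0.
Proof. by case: ifP. Qed.

Lemma theta_quad_alternating J : let n := size (prefix J) in let m := (r ^ J.+1 - 1)%N in
  exists P al al' h, ((2 + 2 * n)%N <= h <= (2 + 2 * n).+1)%N /\
    quad_approx q iF Tl abs xi P al al' h (2 * (n + m) + 3) (2 * n + 1).
Proof.
move=> n m; have [t tE] := theta_prefix_block p r k lam J.
have [y yQ xiE] := theta_mob tE.
have l0 : 0 != lam by rewrite eq_sym.
have m0 : 0 != mu by rewrite eq_sym.
(* The [m.+1] periods have [2 * m.+1] letters, more than [m], so the letter after the common part is
   available: it is [lam] or [mu], against 1 in the expansion. *)
have [rest restE] : exists rest,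
    flatten (nseq m.+1 (rcons [:: lam] mu)) = altw lam mu m ++ (if odd m then mu else lam) :: rest.
  rewrite altw_power (_ : 2 * m.+1 = m + m.+2)%N; last by clear; lia.
  by rewrite altw_add; case: (odd m); eexists.
have cont : bounded_content (rcons [:: lam] mu).
  move=> g + _ _; rewrite !word_mx_cons !word_mx_nil /= mulr1 addr0 dvdpZr // => gX.
  by apply: leq_trans (dvdp_leq _ gX) _; rewrite ?polyX_eq0 // size_polyX.
have := quad_approx_word Habs q_gt1 (notin_theta_prefix r k lam0 mu0 J) _ _ mu1
  (oner_neq0 _) (altw_neq1 m) restE cont yQ xiE.
rewrite size_altw /= => -[].
- by rewrite !inE negb_or l0 m0.
- by [].
move=> P [al [al' [h [hh H]]]]; exists P, al, al', h; split=> //.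
Qed.

Lemma theta_quad_rotated J : let n := (size (prefix J) + k * r ^ J.+1)%N in
  let m := (k.+2 * r ^ J.+2 + (r ^ J.+1 - 1))%N in
  exists P al al' h, ((r ^ J.+2 + 2 * n)%N <= h <= (r ^ J.+2 + 2 * n).+1)%N /\
    quad_approx q iF Tl abs xi P al al' h (2 * (n + m) + 3) (2 * n + 1).
Proof.
move=> n m; have [t tE] := theta_prefix_overlap p k lam r_gt1 J.
have [y yQ xiE] := theta_mob tE.
have V0 := notin_theta_period r lam0 mu0 J; have Vp := theta_overlap_power p r k lam J.
have Vc := @theta_period_content F p r lam odd_r r_gt1 mu1 J.
have VE := theta_periodE p lam r_gt1 J.
have Vs := size_theta_period p lam r_gt1 J.
rewrite VE in V0 Vc Vs; rewrite {1}VE in Vp; rewrite size_rcons in Vs.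
have := quad_approx_word Habs q_gt1 (notin_theta_head r k lam0 mu0 J) V0 _ mu1
  (altw_neq0 _) _ Vp Vc yQ xiE.
move=> -[].
- by case: (altw _ _ _).
- by rewrite eq_sym altw_neq1.
move=> P [al [al' [h [hh H]]]]; exists P, al, al', h.
rewrite size_theta_head // size_theta_overlap // -/n -/m in hh H; split=> //.
have arith (a b n' h' : nat) : a.+1 = b -> (a + 1 + 2 * n' <= h' <= a + 2 + 2 * n')%N ->
  (b + 2 * n' <= h' <= (b + 2 * n').+1)%N by clear; lia.
exact: arith Vs hh.
Qed.

End ThetaApprox.

(** * The two families *)

Section Families.
Variables (R : realType) (F : finFieldType) (L : closedFieldType).
Variables (q : nat) (iF : {rmorphism F -> L}) (Tl : L) (abs : L -> R).
Hypotheses (Habs : is_ext_abs q iF Tl abs) (q_gt1 : (1 < q)%N).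

(** With 1 added, the initial [k] letters count as [(k + 1) r^0], and the length becomes a geometric
    sum. *)
Lemma size_theta_prefixE p r k lam J : (1 < r)%N ->
  ((size (theta_prefix (F := F) p r k lam J))%:R + 1) * (r%:R - 1) = (k%:R + 1) * (r%:R ^+ J.+1 - 1) :> R.
Proof.
move=> r1; elim: J => [|J IH].
  by rewrite /theta_prefix cats0 size_nseq expr1.
rewrite theta_prefixS size_cat natrD size_theta_word // natrM natrX -natr1.
rewrite (_ : (_ + _ + 1) * _ = ((size (theta_prefix p r k lam J))%:R + 1) * (r%:R - 1)
  + (k%:R + 1) * r%:R ^+ J.+1 * (r%:R - 1)); last by ring.
by rewrite IH [in RHS]exprS; ring.
Qed.

Definition exponents_ge xi (A w : R) := forall n, (2 <= n)%N ->
  (A%:E <= wstar_exp q iF Tl abs n xi)%E /\ (w%:E <= w_exp q iF Tl abs n xi)%E.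

Definition exponents_le xi (A w : R) d := forall n, (n <= d)%N ->
  (wstar_exp q iF Tl abs n xi <= A%:E)%E /\ (w_exp q iF Tl abs n xi <= w%:E)%E.

(** Letter counts give exact affine relations in [h0], while the height exponent is [h0] or
    [h0 + 1]. The difference disappears into the constant [C] of the general bounds. *)
Lemma family_exponents xi (A w c1 c2 c3 : R) (r : nat) (h0 e e' : nat -> nat) :
  abs xi <= 1 -> 0 <= A -> 0 <= w ->
  (forall j, exists P al al' h, (h0 j <= h <= (h0 j).+1)%N /\
     quad_approx q iF Tl abs xi P al al' h (e j) (e' j)) ->
  (forall j, j <= h0 j)%N -> (forall j, e' j <= e j)%N ->
  (forall j, (e j)%:R = (1 + A) * (h0 j)%:R + c1) ->
  (forall j, (e j)%:R + (e' j)%:R - (h0 j)%:R = w * (h0 j)%:R + c2) ->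
  (forall j, (h0 j.+1)%:R = r%:R * (h0 j)%:R + c3) ->
  exponents_ge xi A w /\
  (forall d, 1 <= A -> A <= w -> 0 < A + 1 - d%:R ->
     2 * r%:R * d%:R <= (A - 1) * (A + 1 - d%:R) -> exponents_le xi A w d).
Proof.
move=> xi1 A0 w0 Hq hj ee He Hw Hr.
have /boolp.choice[f Hf] : forall j, exists x : {poly {poly F}} * L * L * nat,
    (h0 j <= x.2 <= (h0 j).+1)%N /\
    quad_approx q iF Tl abs xi x.1.1.1 x.1.1.2 x.1.2 x.2 (e j) (e' j).
  by move=> j; have [P [al [al' [h H]]]] := Hq j; exists (P, al, al', h).
pose h j := (f j).2; have HPP j := (Hf j).2.
(* Passing from [h0] to [h] changes the three relations by at most [1 + A], [1 + w] and 1. *)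
pose C := `|c1| + `|c2| + `|c3| + A + w + 2.
have [n1 n2 n3] : [/\ 0 <= `|c1|, 0 <= `|c2| & 0 <= `|c3|] by split.
have [a1 a2 a3] : [/\ c1 <= `|c1|, c2 <= `|c2| & c3 <= `|c3|] by split; apply: ler_norm.
have [b1 b2] : - `|c1| <= c1 /\ - `|c2| <= c2 by split; rewrite lerNl -normrN ler_norm.
have hb j : exists2 z : R, 0 <= z <= 1 & (h j)%:R = (h0 j)%:R + z.
  have /andP[l u] := (Hf j).1; exists ((h j)%:R - (h0 j)%:R); last by ring.
  by rewrite subr_ge0 ler_nat l lerBlDl natr1 ler_nat.
have e_bounds j : (1 + A) * (h j)%:R - C <= (e j)%:R <= (1 + A) * (h j)%:R + C.
  have [z /andP[z0 z1] ->] := hb j; rewrite He /C.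
  have t0 : 0 <= A * z by rewrite mulr_ge0.
  have t1 : A * z <= A by rewrite ler_piMr.
  by apply/andP; split; lra.
have w_bounds j : w * (h j)%:R - C <= (e j)%:R + (e' j)%:R - (h j)%:R <= w * (h j)%:R + C.
  have [z /andP[z0 z1] ->] := hb j; have := Hw j; rewrite /C.
  have t0 : 0 <= w * z by rewrite mulr_ge0.
  have t1 : w * z <= w by rewrite ler_piMr.
  by move=> E; apply/andP; split; lra.
have h_unb N : exists j, (N <= h j)%N.
  by exists N; apply: leq_trans (hj N) _; have /andP[] := (Hf N).1.
split=> [n n2'|d A1 Aw Ad gap n nd].
  split; first exact: (wstar_exp_lower Habs q_gt1 HPP A0 h_unb e_bounds n2').
  exact: (w_exp_lower Habs q_gt1 HPP h_unb w_bounds n2').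
have C0 : 0 <= C by rewrite /C; lra.
have growth j : (h j.+1)%:R <= r%:R * (h j)%:R + C.
  have [z /andP[z0 z1] ->] := hb j; have [z' /andP[z0' z1'] ->] := hb j.+1.
  rewrite Hr /C; have : 0 <= r%:R * z by rewrite mulr_ge0.
  by lra.
split.
- exact: (wstar_exp_upper Habs q_gt1 xi1 HPP h_unb e_bounds A1 C0 ee growth Ad gap nd).
- exact: (w_exp_upper Habs q_gt1 xi1 HPP h_unb e_bounds w_bounds A1 Aw C0 growth Ad gap nd).
Qed.

Section Theta.
Variables (p r k : nat) (lam : F) (xi : L).
Hypotheses (odd_r : odd r = (p != 2%N)) (r_gt1 : (1 < r)%N).
Local Notation mu := (theta_mu p lam).
Hypotheses (lam0 : lam != 0) (lam1 : lam != 1) (mu0 : mu != 0) (mu1 : mu != 1).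
Hypothesis Hxi : cf_value iF Tl abs (theta_pq p r k lam) xi.

Local Notation rr := (r%:R : R).
Local Notation kk := (k%:R : R).
Local Notation D := (2 * rr * (kk + 1) + (rr - 1) * (rr - 2)).
Local Notation A := ((rr - 1) / (kk + 1)).
Local Notation B := (rr - 1 - rr * (rr - 1) * (rr - 4) / D).
Local Notation B' := (rr - rr * (rr - 1) * (rr - 3) / D).

Let r2 : 2 <= rr. Proof. by rewrite ler_nat. Qed.
Let k0 : 0 <= kk. Proof. by []. Qed.
Let k1 : kk + 1 != 0. Proof. by apply: lt0r_neq0; move: k0 r2; lra. Qed.
Let r1 : rr - 1 != 0. Proof. by apply: lt0r_neq0; move: k0 r2; lra. Qed.

Lemma theta_D_gt0 : 0 < D.
Proof.
apply: ltr_wpDr; first by rewrite mulr_ge0; move: k0 r2; lra.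
by rewrite !mulr_gt0; move: k0 r2; lra.
Qed.

Lemma theta_prefix_sizeE J :
  (size (theta_prefix p r k lam J))%:R = (kk + 1) * (rr ^+ J.+1 - 1) / (rr - 1) - 1.
Proof.
by rewrite -(size_theta_prefixE p k lam J r_gt1) mulfK // addrK.
Qed.

Lemma rXE J : (r ^ J.+1 - 1)%:R = rr ^+ J.+1 - 1.
Proof. by rewrite natrB ?natrX // expn_gt0 ltnW. Qed.

(** With [n] the prefix length and [m] the length of the alternating run, the geometric sum gives
    [A (n + 1) = m]; this fixes both slopes. *)
Lemma theta_exponents_alternating : exponents_ge xi A (A + 1) /\
  (forall d, 1 <= A -> 0 < A + 1 - d%:R ->
     2 * rr * d%:R <= (A - 1) * (A + 1 - d%:R) -> exponents_le xi A (A + 1) d).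
Proof.
have A0 : 0 <= A by rewrite divr_ge0; move: k0 r2; lra.
have A1 : 0 <= A + 1 by move: A0; lra.
pose n J := size (theta_prefix p r k lam J); pose m J := (r ^ J.+1 - 1)%N.
have [||||||ge le] := @family_exponents xi A (A + 1) 1 0 (2 * (kk + 1)) r
  (fun J => (2 + 2 * n J)%N) (fun J => (2 * (n J + m J) + 3)%N) (fun J => (2 * n J + 1)%N)
  (theta_abs_le1 Habs q_gt1 odd_r r_gt1 lam0 mu0 Hxi) A0 A1.
- by move=> J; exact: (theta_quad_alternating Habs q_gt1 odd_r r_gt1 lam0 lam1 mu0 mu1 Hxi J).
- by move=> J; have := size_theta_prefix p k lam r_gt1 J; rewrite -/(n J); clear; lia.
- by move=> J; clear; lia.
- move=> J; rewrite !(natrD, natrM) /n /m theta_prefix_sizeE rXE.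
  by field; rewrite k1 r1.
- move=> J; rewrite !(natrD, natrM) /n /m theta_prefix_sizeE rXE.
  by field; rewrite k1 r1.
- move=> J; rewrite !(natrD, natrM) /n !theta_prefix_sizeE exprS.
  by field; rewrite r1.
by split=> // d *; apply: le => //; rewrite lerDl.
Qed.

Lemma theta_B_ge1 : 1 <= B.
Proof.
rewrite -subr_ge0 (_ : _ - 1 = (2 * rr * (rr - 2) * (kk + 1) + 4 * (rr - 1)) / D).
  rewrite divr_ge0 ?(ltW theta_D_gt0) // addr_ge0 ?mulr_ge0 //; move: k0 r2; lra.
by have := lt0r_neq0 theta_D_gt0 => D0; field.
Qed.

Lemma theta_B_le : B <= B'.
Proof.
rewrite -subr_ge0 (_ : _ - _ = (2 * rr * kk + 2) / D).
  by rewrite divr_ge0 ?(ltW theta_D_gt0) // addr_ge0 ?mulr_ge0.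
by have := lt0r_neq0 theta_D_gt0 => D0; field.
Qed.

Lemma theta_exponents_rotated : exponents_ge xi B B' /\
  (forall d, 0 < B + 1 - d%:R ->
     2 * rr * d%:R <= (B - 1) * (B + 1 - d%:R) -> exponents_le xi B B' d).
Proof.
have Bge1 := theta_B_ge1; have BB' := theta_B_le; have D0 := lt0r_neq0 theta_D_gt0.
have B0 : 0 <= B by apply: le_trans Bge1.
have B'0 : 0 <= B' by apply: le_trans BB'.
pose n J := (size (theta_prefix p r k lam J) + k * r ^ J.+1)%N.
pose m J := (k.+2 * r ^ J.+2 + (r ^ J.+1 - 1))%N.
(* In terms of [X = r^(J+1)] the height exponent is [X D / (r - 1) + c0]; the other constants follow
   by eliminating [X]. *)
pose c0 := - (2 * (kk + 1) / (rr - 1)) - 2.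
have nE J : (n J)%:R = (kk + 1) * (rr * rr ^+ J.+1 - 1) / (rr - 1) - 1 - rr ^+ J.+1.
  rewrite /n natrD natrM natrX theta_prefix_sizeE; by field.
have mE J : (m J)%:R = (kk + 2) * (rr * rr ^+ J.+1) + rr ^+ J.+1 - 1.
  by rewrite /m natrD natrM natrX rXE -addn2 natrD exprS addrA.
have n_ge J : (J <= n J)%N := leq_trans (size_theta_prefix p k lam r_gt1 J) (leq_addr _ _).
(* The approximations are stated before the bodies of [n] and [m] are cleared, so that the later
   algebra sees only [nE] and [mE]. *)
have quad J : exists P al al' h, ((r ^ J.+2 + 2 * n J)%N <= h <= (r ^ J.+2 + 2 * n J).+1)%N /\
    quad_approx q iF Tl abs xi P al al' h (2 * (n J + m J) + 3) (2 * n J + 1).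
  exact: (theta_quad_rotated Habs q_gt1 odd_r r_gt1 lam0 lam1 mu0 mu1 Hxi J).
clearbody n m.
have hE J : (r ^ J.+2 + 2 * n J)%:R = rr * rr ^+ J.+1 + 2 * (n J)%:R.
  by rewrite natrD natrX exprS natrM.
have eE J : (2 * (n J + m J) + 3)%:R = 2 * ((n J)%:R + (m J)%:R) + 3 :> R.
  by rewrite natrD natrM natrD.
have e'E J : (2 * n J + 1)%:R = 2 * (n J)%:R + 1 :> R by rewrite natrD natrM.
have [||||||ge le] := @family_exponents xi B B'
  (- (2 * (kk + 1) / (rr - 1)) - 1 - (1 + B) * c0)
  (- (2 * (kk + 1) / (rr - 1)) - B' * c0) ((1 - rr) * c0) r
  (fun J => (r ^ J.+2 + 2 * n J)%N) (fun J => (2 * (n J + m J) + 3)%N) (fun J => (2 * n J + 1)%N)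
  (theta_abs_le1 Habs q_gt1 odd_r r_gt1 lam0 mu0 Hxi) B0 B'0.
- exact: quad.
- by move=> J; apply: leq_trans (n_ge J) _; apply: leq_trans (leq_addl _ _); rewrite leq_pmull.
- by move=> J; clear; lia.
- by move=> J; rewrite eE hE nE mE /c0; field; rewrite r1 D0.
- by move=> J; rewrite eE e'E hE nE mE /c0; field; rewrite r1 D0.
- by move=> J; rewrite !hE !nE (exprS _ J.+1) /c0; field; rewrite r1.
by split=> // d *; apply: le.
Qed.

End Theta.

End Families.

(** * Values of the exponents of Theta *)

Local Open Scope classical_set_scope.
Unset Implicit Arguments.

Theorem theorem3p1 (R : realType) (F : finFieldType) (L : closedFieldType)
  (p s t q r k d : nat) (lam : F)
  (iF : {rmorphism F -> L}) (Tl : L) (abs : L -> R) (xi : L) :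
  prime p -> (0 < s)%N -> (0 < t)%N -> q = (p ^ s)%N -> r = (q ^ t)%N ->
  #|F| = q -> (2 <= d)%N ->
  lam != 0 -> lam != 1 -> (p != 2%N -> lam != 2) ->
  is_ext_abs q iF Tl abs ->
  cf_value iF Tl abs (theta_pq p r k lam) xi ->
  let rr : R := r%:R in
  let kk : R := k%:R in
  let dd : R := d%:R in
  let D : R := 2 * rr * (kk + 1) + (rr - 1) * (rr - 2) in
  let A : R := (rr - 1) / (kk + 1) in
  let B : R := rr - 1 - rr * (rr - 1) * (rr - 4) / D in
  let B' : R := rr - rr * (rr - 1) * (rr - 3) / D in
  [/\ ((Num.max A B)%:E <= wstar_exp q iF Tl abs 2 xi)%E,
      ((Num.max (A + 1) B')%:E <= w_exp q iF Tl abs 2 xi)%E,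
      kk <= 2 * (rr - 1) / (dd + Num.sqrt (dd ^+ 2 + 4 * (2 * rr - 1) * dd + 4)) - 1 ->
        forall n : nat, (2 <= n <= d)%N ->
          wstar_exp q iF Tl abs n xi = A%:E /\ w_exp q iF Tl abs n xi = (A + 1)%:E
    & 2 * rr * dd <= (rr - 2 - rr * (rr - 1) * (rr - 4) / D)
                     * (rr - dd - rr * (rr - 1) * (rr - 4) / D) ->
        forall n : nat, (2 <= n <= d)%N ->
          wstar_exp q iF Tl abs n xi = B%:E /\ w_exp q iF Tl abs n xi = B'%:E].
Proof.
move=> pp s0 t0 qE rE _ d2 lam0 lam1 lam2 Habs Hxi rr kk dd D A B B'.
have p1 := prime_gt1 pp.
have q1 : (1 < q)%N by rewrite qE (leq_trans p1) // -{1}(expn1 p) leq_exp2l.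
have r1 : (1 < r)%N by rewrite rE (leq_trans q1) // -{1}(expn1 q) leq_exp2l.
have odd_r : odd r = (p != 2%N).
  have -> : odd r = odd p by rewrite rE qE -expnM oddX muln_eq0 !gtn_eqF.
  case: (even_prime pp) => [-> //|op]; rewrite op; apply/esym.
  by apply: contraTneq op => ->.
have mu0 : theta_mu p lam != 0.
  by rewrite /theta_mu; case: ifP => // /lam2; rewrite subr_eq0 eq_sym.
have mu1 : theta_mu p lam != 1.
  rewrite /theta_mu; case: ifP => // _; rewrite subr_eq addrC.
  by rewrite (_ : 2 = 1 + 1 :> F) // (inj_eq (addIr 1)) eq_sym.
have [gA lA] := theta_exponents_alternating Habs q1 odd_r r1 lam0 lam1 mu0 mu1 Hxi.
have [gB lB] := theta_exponents_rotated Habs q1 odd_r r1 lam0 lam1 mu0 mu1 Hxi.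
have rr2 : 2 <= rr by rewrite ler_nat.
have kk0 : 0 <= kk by [].
have dd2 : 2 <= dd by rewrite ler_nat.
split.
- by rewrite maxEle; case: ifP => _; [case: (gB 2) | case: (gA 2)].
- by rewrite maxEle; case: ifP => _; [case: (gB 2) | case: (gA 2)].
- set S := Num.sqrt _ => Hk n /andP[n2 nd].
  have S0 : 0 <= S by apply: sqrtr_ge0.
  have rad0 : 0 <= dd ^+ 2 + 4 * (2 * rr - 1) * dd + 4.
    by rewrite !addr_ge0 ?mulr_ge0 ?sqr_ge0 //; lra.
  have S2 : S ^+ 2 = dd ^+ 2 + 4 * (2 * rr - 1) * dd + 4 by apply: sqr_sqrtr.
  (* The bound on [k] says that [A] is at least [(dd + S) / 2], the larger root of
     [(A - 1) (A + 1 - dd) = 2 rr dd]. *)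
  have AS : dd + S <= 2 * A.
    have dS : 0 < dd + S by lra.
    have kk1 : 0 < kk + 1 by lra.
    rewrite /A mulrA ler_pdivlMr // mulrC -ler_pdivlMr //.
    by move: Hk; lra.
  have rd : 0 <= (rr - 2) * dd by apply: mulr_ge0; [rewrite subr_ge0 | lra].
  have Sd : dd <= S.
    by rewrite -(ler_pXn2r (n := 2)) ?nnegrE // S2; lra.
  have gap : 2 * rr * dd <= (A - 1) * (A + 1 - dd).
    have : S ^+ 2 <= (2 * A - dd) ^+ 2.
      by rewrite ler_pXn2r ?nnegrE //; lra.
    by rewrite S2; lra.
  have A1 : 1 <= A by lra.
  have Ad : 0 < A + 1 - dd by lra.
  have [le1 le2] := lA d A1 Ad gap n nd.
  have [ge1 ge2] := gA n n2.
  by split; apply/eqP; rewrite eq_le ?le1 ?le2 ?ge1 ?ge2.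
- have B1 : 1 <= B := theta_B_ge1 R k r1.
  move=> gap0 n /andP[n2 nd].
  have gap : 2 * rr * dd <= (B - 1) * (B + 1 - dd).
    have -> : B - 1 = rr - 2 - rr * (rr - 1) * (rr - 4) / D by rewrite /B; lra.
    have -> // : B + 1 - dd = rr - dd - rr * (rr - 1) * (rr - 4) / D by rewrite /B; lra.
  (* The product in [gap] is positive and [B - 1] is nonnegative, which forces the sign of the other
     factor. *)
  have Bd : 0 < B + 1 - dd.
    have pos : 0 < 2 * rr * dd by rewrite !mulr_gt0 //; lra.
    have : 0 < (B - 1) * (B + 1 - dd) by apply: lt_le_trans gap.
    by apply: contraTT; rewrite -!leNgt => neg; rewrite mulr_ge0_le0 // subr_ge0.
  have [le1 le2] := lB d Bd gap n nd.
  have [ge1 ge2] := gB n n2.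
  by split; apply/eqP; rewrite eq_le ?le1 ?le2 ?ge1 ?ge2.
Qed.
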